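(* Let $\Psi=\{|\psi_1\rangle,|\psi_2\rangle,\dots\}$ be a resource, $|\psi_i\rangle$ a state on $N_i$ qubits. If one of the measures $E_{\mathrm{wd}}$, $\chi_{\mathrm{wd}}$, $\mathcal{N}_{\mathrm{LE}}$, $E_g$ or $E_s$ scales at most logarithmically with the system size on $\Psi$ (i.e. its value on $|\psi_i\rangle$ is $O(\log N_i)$), then $\Psi$ is not an efficient universal resource.
   Context: Write $|\psi\rangle\geq_{\mathrm{LOCC}}|\phi\rangle$ (for $N$-qubit $|\psi\rangle$, $n$-qubit $|\phi\rangle$, $n\le N$) if for some set $A$ of $n$ qubits $|\psi\rangle\to|\phi\rangle^A|0\rangle^{\bar A}$ is achievable exactly with probability one by LOCC (each qubit a party). A resource is an infinite family of multi-qubit pure states. $\Psi$ is an efficient universal resource if for every family $\{|\phi^{(n)}\rangle\}_{n\ge1}$ ($|\phi^{(n)}\rangle$ on $n$ qubits) preparable from product states by a family of quantum circuits of size $\mathrm{poly}(n)$, there is a subfamily $\{|\psi_{i_n}\rangle\}\subseteq\Psi$ with $|\psi_{i_n}\rangle$ on at most $N=\mathrm{poly}(n)$ qubits such that $|\psi_{i_n}\rangle\to|\phi^{(n)}\rangle|0\rangle^{\otimes(N-n)}$ is achievable exactly and deterministically by LOCC with $\mathrm{poly}(n)$ non-parallelizable time steps and with classical side-processing polynomially bounded in space and time. Measures: for a subcubic tree $T$ (degrees in $\{1,3\}$) whose leaves are the qubits, removing edge $e$ induces a bipartition $(A^e_T,B^e_T)$; with $\rho_A=\mathrm{Tr}_B|\psi\rangle\langle\psi|$,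 $E_{\mathrm{wd}}=\min_T\max_e(-\mathrm{Tr}\rho_{A^e_T}\log_2\rho_{A^e_T})$ and $\chi_{\mathrm{wd}}=\min_T\max_e\log_2\mathrm{rank}\rho_{A^e_T}$. $\mathcal{N}_{\mathrm{LE}}(|\psi\rangle)$ is the largest size of a set $A$ of qubits such that for all distinct $\alpha,\beta\in A$, LOCC can deterministically and exactly produce $\frac1{\sqrt2}(|00\rangle+|11\rangle)$ on $\alpha,\beta$ from $|\psi\rangle$. $E_g(|\psi\rangle)=-\log_2\max|\langle\psi|\varphi_1\otimes\cdots\otimes\varphi_N\rangle|^2$ over product states. $E_s(|\psi\rangle)=\log_2K$, $K$ the minimal number of product states whose linear span contains $|\psi\rangle$. *)

(* Defs.v *)
From HB Require Import structures.
From mathcomp Require Import all_boot all_order all_algebra.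
From mathcomp Require Import complex.
From mathcomp Require Import boolp classical_sets reals Rstruct exp.

Set Implicit Arguments.
Unset Strict Implicit.
Unset Printing Implicit Defensive.

Import Order.TTheory GRing.Theory Num.Theory.
Local Open Scope ring_scope.

Definition R : realType := Rdefinitions.R.
Definition C : numClosedFieldType := (Rdefinitions.R)[i].

Definition cconj (z : C) : C := Num.conj z.
Definition abs2 (z : C) : R := complex.Re (z * cconj z).
Definition log2 (x : R) : R := ln x / ln 2.
Definition xlog2x (x : R) : R := if x == 0 then 0 else x * log2 x.

(* N-qubit vectors: amplitudes indexed by computational basis strings   *)
Definition bits (N : nat) := {ffun 'I_N -> bool}.
Definition vec (N : nat) := {ffun bits N -> C}.

Definition inner (N : nat) (psi phi : vec N) : C :=
  \sum_(x : bits N) cconj (psi x) * phi x.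

Definition is_state (N : nat) (psi : vec N) : Prop := inner psi psi = 1.

(* single-qubit operators, as matrices <a|K|b> = K a b *)
Definition qop := bool -> bool -> C.

Definition prod_apply (N : nat) (ops : 'I_N -> qop) (psi : vec N) : vec N :=
  [ffun x : bits N => \sum_(y : bits N) (\prod_(k < N) ops k (x k) (y k)) * psi y].

(* Kraus operators of a (fine-grained) single-qubit instrument:
   sum_j K_j^dagger K_j = 1 *)
Definition complete_instr (m : nat) (K : 'I_m -> qop) : Prop :=
  forall a b : bool,
    \sum_(j < m) \sum_(c : bool) cconj (K j c a) * K j c b = (a == b)%:R.

(* LOCC protocols (each qubit is a party).  In one (time step) round    *)
(* every qubit k applies an instrument with m k outcomes (m k = 1 with  *)
(* a unitary Kraus operator covers "do a local unitary / nothing"); the *)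
(* outcomes are broadcast and the rest of the protocol may depend on    *)
(* all outcomes so far.                                                 *)
Inductive locc (N : nat) : Type :=
| LDone : locc N
| LRound : forall m : 'I_N -> nat,
    (forall k : 'I_N, 'I_(m k) -> qop) ->
    ((forall k : 'I_N, 'I_(m k)) -> locc N) -> locc N.

Arguments LDone {N}.

Fixpoint locc_valid (N : nat) (P : locc N) : Prop :=
  match P with
  | LDone => True
  | LRound m K nx => (forall k, complete_instr (K k)) /\
                     (forall j, locc_valid (nx j))
  end.

Fixpoint locc_depth_le (N : nat) (P : locc N) (d : nat) : Prop :=
  match P with
  | LDone => True
  | LRound m K nx =>
      match d with
      | 0 => False
      | d'.+1 => forall j, locc_depth_le (nx j) d'
      end
  end.

(* exact, deterministic conversion: on every branch the final
   (unnormalized) vector is proportional to the target *)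
Fixpoint locc_achieves (N : nat) (P : locc N) (psi target : vec N) : Prop :=
  match P with
  | LDone => exists c : C, psi = c *: target
  | LRound m K nx =>
      forall j, locc_achieves (nx j) (prod_apply (fun k => K k (j k)) psi) target
  end.

(* |phi>^A |0>^{complement of A}, where the n qubits of phi are placed on
   the qubits f 0, ..., f (n-1) of the N-qubit system *)
Definition embed (n N : nat) (f : 'I_n -> 'I_N) (phi : vec n) : vec N :=
  [ffun x : bits N =>
     if [forall k, (k \notin codom f) ==> ~~ x k]
     then phi [ffun i => x (f i)] else 0].

Definition locc_ge (N n : nat) (psi : vec N) (phi : vec n) : Prop :=
  exists f : 'I_n -> 'I_N, injective f /\
  exists P : locc N, locc_valid P /\ locc_achieves P psi (embed f phi).

Inductive gate (N : nat) : Type :=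
| G1 : 'I_N -> qop -> gate N
| G2 : 'I_N -> 'I_N -> (bool * bool -> bool * bool -> C) -> gate N.

Definition unitary1 (U : qop) : Prop :=
  forall a b : bool, \sum_(c : bool) cconj (U c a) * U c b = (a == b)%:R.

Definition unitary2 (U : bool * bool -> bool * bool -> C) : Prop :=
  forall a b : bool * bool,
    \sum_(c : bool * bool) cconj (U c a) * U c b = (a == b)%:R.

Definition gate_valid (N : nat) (g : gate N) : Prop :=
  match g with
  | G1 _ U => unitary1 U
  | G2 i j U => i != j /\ unitary2 U
  end.

Definition upd (N : nat) (x : bits N) (i : 'I_N) (b : bool) : bits N :=
  [ffun k => if k == i then b else x k].

Definition apply_gate (N : nat) (g : gate N) (psi : vec N) : vec N :=
  match g with
  | G1 i U => [ffun x : bits N => \sum_(b : bool) U (x i) b * psi (upd x i b)]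
  | G2 i j U => [ffun x : bits N =>
      \sum_(bc : bool * bool) U (x i, x j) bc * psi (upd (upd x i bc.1) j bc.2)]
  end.

Definition zero_state (N : nat) : vec N :=
  [ffun x : bits N => (x == [ffun => false])%:R].

Definition run_circuit (N : nat) (c : seq (gate N)) : vec N :=
  foldl (fun psi g => apply_gate g psi) (zero_state N) c.

Definition poly_bounded (f : nat -> nat) : Prop :=
  exists c : nat, forall n, (f n <= c * n.+1 ^ c)%N.

Definition poly_preparable (phi : forall n, vec n) : Prop :=
  exists circ : forall n, seq (gate n),
    poly_bounded (fun n => size (circ n)) /\
    forall n, (0 < n)%N -> (forall g, List.In g (circ n) -> gate_valid g) /\
                       phi n = run_circuit (circ n).

Definition eff_universal (Nq : nat -> nat) (psi : forall i, vec (Nq i)) : Prop :=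
  forall phi : forall n, vec n, poly_preparable phi ->
  exists idx : nat -> nat, exists c : nat,
    forall n, (0 < n)%N ->
      (Nq (idx n) <= c * n.+1 ^ c)%N /\
      exists f : 'I_n -> 'I_(Nq (idx n)), injective f /\
      exists P : locc (Nq (idx n)),
        locc_valid P /\ locc_depth_le P (c * n.+1 ^ c)%N /\
        locc_achieves P (psi (idx n)) (embed f (phi n)).

(* basis strings of the subsystem A (represented as full strings that
   vanish outside A) *)
Definition bitsOn (N : nat) (A : {set 'I_N}) :=
  {x : bits N | [forall i, (i \notin A) ==> ~~ x i]}.

Definition glue (N : nat) (A : {set 'I_N}) (x y : bits N) : bits N :=
  [ffun i => if i \in A then x i else y i].

(* rho_A = Tr_B |psi><psi| *)
Definition rho (N : nat) (A : {set 'I_N}) (psi : vec N) : 'M[C]_(#|{: bitsOn A}|) :=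
  \matrix_(i, j)
    \sum_(z : bitsOn (~: A))
      psi (glue A (val (enum_val i)) (val z)) *
      cconj (psi (glue A (val (enum_val j)) (val z))).

Definition eigs (m : nat) (M : 'M[C]_m) : seq C :=
  projT1 (closed_field_poly_normal (char_poly M)).

Definition entropy (N : nat) (A : {set 'I_N}) (psi : vec N) : R :=
  - \sum_(l <- eigs (rho A psi)) xlog2x (complex.Re l).

Definition logrank (N : nat) (A : {set 'I_N}) (psi : vec N) : R :=
  log2 (\rank (rho A psi))%:R.

Record subcubic_tree (N : nat) := SubcubicTree {
  st_size : nat;
  st_adj : rel 'I_st_size;
  st_leaf : 'I_N -> 'I_st_size;
  st_sym : symmetric st_adj;
  st_irr : irreflexive st_adj;
  st_conn : forall u v, connect st_adj u v;
  st_edges : #|[set p : 'I_st_size * 'I_st_size | st_adj p.1 p.2]|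
             = (st_size.-1).*2;
  st_deg : forall v, #|[set w | st_adj v w]| \in [:: 1%N; 3%N];
  st_leaf_inj : injective st_leaf;
  st_leaves : forall v, #|[set w | st_adj v w]| = 1%N -> exists i, st_leaf i = v
}.

Definition cut_adj (M : nat) (adj : rel 'I_M) (u v : 'I_M) : rel 'I_M :=
  fun x y => adj x y && ~~ (((x == u) && (y == v)) || ((x == v) && (y == u))).

Definition cut_side (N : nat) (T : subcubic_tree N) (u v : 'I_(st_size T))
  : {set 'I_N} :=
  [set i | connect (cut_adj (@st_adj N T) u v) u (@st_leaf N T i)].

Definition tree_width (N : nat) (T : subcubic_tree N) (f : {set 'I_N} -> R) : R :=
  \big[Num.max/0]_(p : 'I_(st_size T) * 'I_(st_size T) |
                     (p.1 < p.2)%N && @st_adj N T p.1 p.2)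
     f (@cut_side N T p.1 p.2).

Definition Ewd (N : nat) (psi : vec N) : R :=
  inf [set x | exists T : subcubic_tree N, x = tree_width T (fun A => entropy A psi)].

Definition chiwd (N : nat) (psi : vec N) : R :=
  inf [set x | exists T : subcubic_tree N, x = tree_width T (fun A => logrank A psi)].

Definition bell : vec 2 :=
  [ffun x : bits 2 =>
     if x ord0 == x ord_max then ((Num.sqrt (2 : R))^-1 +i* 0)%C else 0].

Definition pair_map (N : nat) (a b : 'I_N) : 'I_2 -> 'I_N :=
  fun i => if i == ord0 then a else b.

Definition bell_obtainable (N : nat) (psi : vec N) (a b : 'I_N) : Prop :=
  exists P : locc N, locc_valid P /\ locc_achieves P psi (embed (pair_map a b) bell).

Definition NLE (N : nat) (psi : vec N) : R :=
  (\big[maxn/0%N]_(A : {set 'I_N} |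
      `[< forall a b, a \in A -> b \in A -> a != b -> bell_obtainable psi a b >])
     #|A|)%:R.

Definition unit_qubit (v : bool -> C) : Prop :=
  cconj (v false) * v false + cconj (v true) * v true = 1.

Definition prodvec (N : nat) (ph : 'I_N -> bool -> C) : vec N :=
  [ffun x : bits N => \prod_(k < N) ph k (x k)].

Definition Eg (N : nat) (psi : vec N) : R :=
  - log2 (sup [set x | exists ph : 'I_N -> bool -> C,
                  (forall k, unit_qubit (ph k)) /\ x = abs2 (inner psi (prodvec ph))]).

Definition Es (N : nat) (psi : vec N) : R :=
  log2 (inf [set x | exists K : nat, x = K%:R /\
     exists phs : 'I_K -> 'I_N -> bool -> C,
       (forall j k, unit_qubit (phs j k)) /\
       exists a : 'I_K -> C, psi = \sum_(j < K) a j *: prodvec (phs j)]).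

Definition log_scaling (M : forall N, vec N -> R)
  (Nq : nat -> nat) (psi : forall i, vec (Nq i)) : Prop :=
  exists c : R, forall i, M (Nq i) (psi i) <= c * (1 + log2 (Nq i)%:R).

Arguments log_scaling M Nq psi : clear implicits.
Arguments eff_universal Nq psi : clear implicits.

(* Main.v *)
Require Import Defs.
From mathcomp Require Import all_boot all_order all_algebra.
From mathcomp Require Import complex.
From mathcomp Require Import boolp classical_sets reals Rstruct exp.
From mathcomp Require Import sesquilinear spectral zify ring.

Set Implicit Arguments.
Unset Strict Implicit.
Unset Printing Implicit Defensive.

Import Order.TTheory GRing.Theory Num.Theory.
Local Open Scope ring_scope.

(** For a cut (A, B) of the qubits let mu be the largest squared overlap of a state with a
    vector that is a product across the cut.  Kraus operators of LOCC protocols are local,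
    so they preserve such product vectors, and Cauchy-Schwarz together with completeness of
    the instruments shows that mu cannot be larger for the resource than for the state it is
    converted to.  On the other hand - log2 mu is a lower bound for the entropy and for the
    log-rank across the cut, for [Eg] and for [Es].  The k x k grid graph state has
    mu <= 2^-(k/8) across every balanced cut: such a cut splits all rows or k/4 columns, and
    every second of them contributes an edge to an induced matching between the two sides.
    As every subcubic tree has an edge that splits the target qubits in a balanced way, these
    four measures are at least 2^(m-3) on resources producing the 2^m x 2^m grid, although
    the number N of resource qubits satisfies log2 N = O(m).  For [NLE] the
    target is the GHZ state, from which every pair of qubits can be projected onto a Bell
    pair. *)

(** * Finite sums, conjugation and the Cauchy-Schwarz inequality *)

(** Distributivity with an index type that depends on the factor: each qubit has its own number of
    measurement outcomes. *)
Lemma prod_sum_fprod (K : comPzSemiRingType) (I : finType) (T : I -> finType)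
    (F : forall i, T i -> K) :
  \prod_i \sum_(j : T i) F i j = \sum_(t : fprod T) \prod_i F i (t i).
Proof.
transitivity (\sum_(t : fprod T) \prod_(i in I) [ffun j => F i j] (t i)).
  rewrite big_fprod /=.
  under eq_bigr => i _ do rewrite (big_tag F).
  rewrite bigA_distr_big_dep; apply: eq_bigr => g gP.
  apply: eq_bigr => i _; case: (g i) => j t /=; rewrite /untag.
  by case: eqP => // e; rewrite ffunE.
by apply: eq_bigr => t _; apply: eq_bigr => i _; rewrite ffunE.
Qed.

Lemma cconj_sum (I : finType) (P : pred I) (F : I -> C) :
  cconj (\sum_(i | P i) F i) = \sum_(i | P i) cconj (F i).
Proof. exact: rmorph_sum. Qed.

Lemma cconj_prod (I : finType) (P : pred I) (F : I -> C) :
  cconj (\prod_(i | P i) F i) = \prod_(i | P i) cconj (F i).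
Proof. exact: rmorph_prod. Qed.

Lemma cconjM : {morph cconj : x y / x * y}.
Proof. exact: rmorphM. Qed.

Lemma normC2 (z : C) : `|z| ^+ 2 = cconj z * z.
Proof. by rewrite normCK mulrC. Qed.

Lemma norm2_innerxx (N : nat) (w : vec N) :
  inner w w = \sum_x `|w x| ^+ 2.
Proof. by apply: eq_bigr => x _; rewrite normC2. Qed.

Lemma inner_ge0 (N : nat) (w : vec N) : 0 <= inner w w.
Proof. by rewrite norm2_innerxx sumr_ge0 // => x _; rewrite exprn_ge0. Qed.

(** This form recombines the branches of a protocol: each branch supplies its own bound with weights
    [p i] and [q i], and the sums inherit it. Pairs of indices are compared by the
    arithmetic-geometric mean inequality. *)
Lemma cauchy_sum (I : finType) (P : pred I) (z p q : I -> C) :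
    (forall i, P i -> 0 <= p i) -> (forall i, P i -> 0 <= q i) ->
    (forall i, P i -> `|z i| ^+ 2 <= p i * q i) ->
  `|\sum_(i | P i) z i| ^+ 2 <= (\sum_(i | P i) p i) * (\sum_(i | P i) q i).
Proof.
move=> p0 q0 zpq.
(* With a^2 = p_i q_j and b^2 = p_j q_i the hypothesis gives |z_i| |z_j| <= ab, and 2ab <= a^2 +
   b^2. *)
have zz i j : P i -> P j ->
    `|z i| * `|z j| + `|z j| * `|z i| <= p i * q j + p j * q i.
  move=> Pi Pj; pose a := sqrtC (p i * q j); pose b := sqrtC (p j * q i).
  have a0 : 0 <= a by rewrite sqrtC_ge0 mulr_ge0 ?p0 ?q0.
  have b0 : 0 <= b by rewrite sqrtC_ge0 mulr_ge0 ?p0 ?q0.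
  have zab : `|z i| * `|z j| <= a * b.
    rewrite -(ler_pXn2r (n := 2)) ?nnegrE ?mulr_ge0 //.
    rewrite !exprMn !sqrtCK.
    have -> : p i * q j * (p j * q i) = (p i * q i) * (p j * q j) by ring.
    by apply: ler_pM; rewrite ?exprn_ge0 ?zpq.
  have -> : p i * q j + p j * q i = a ^+ 2 + b ^+ 2 by rewrite !sqrtCK.
  apply: (le_trans (lerD zab (_ : _ <= b * a))); first by rewrite mulrC [b * a]mulrC.
  rewrite -subr_ge0.
  have -> : a ^+ 2 + b ^+ 2 - (a * b + b * a) = (a - b) ^+ 2 by ring.
  by rewrite real_exprn_even_ge0 // rpredB ?ger0_real.
have le1 : `|\sum_(i | P i) z i| ^+ 2 <= (\sum_(i | P i) `|z i|) ^+ 2.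
  by rewrite ler_pXn2r ?nnegrE ?sumr_ge0 // ler_norm_sum.
apply: (le_trans le1); rewrite -(ler_pM2r (x := 2)) ?ltr0n //.
(* Doubling makes the double sums symmetric in [i] and [j], so that [zz] applies term by term. *)
have dbl (f g : I -> C) : (\sum_(i | P i) f i) * (\sum_(i | P i) g i) * 2 =
    \sum_(i | P i) \sum_(j | P j) (f i * g j + f j * g i).
  rewrite mulr_natr mulr2n big_distrlr /=; under [RHS]eq_bigr do rewrite big_split.
  by rewrite big_split /= [X in _ + X = _]exchange_big.
rewrite expr2 !dbl; apply: ler_sum => i Pi; apply: ler_sum => j Pj; exact: zz.
Qed.

(** * Monotonicity of overlaps under LOCC *)

(** Completeness of the one-qubit instruments tensorizes: the products K_j^dagger K_j, summed over
    all outcome strings [j], give the identity. *)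
Lemma inner_prod_apply (N : nat) (m : 'I_N -> nat) (K : forall k, 'I_(m k) -> qop)
    (psi w : vec N) :
    (forall k, complete_instr (K k)) ->
  inner psi w = \sum_(j : fprod (fun k => 'I_(m k)))
    inner (prod_apply (fun k => K k (j k)) psi) (prod_apply (fun k => K k (j k)) w).
Proof.
move=> Kc.
(* The matrix entries of that operator sum factor over the qubits, and completeness turns each
   factor into a Kronecker delta. *)
have kernel (y z : bits N) :
    \sum_(j : fprod (fun k => 'I_(m k))) \sum_(x : bits N)
       (cconj (\prod_k K k (j k) (x k) (y k)) * \prod_k K k (j k) (x k) (z k))
    = (y == z)%:R.
  transitivity (\prod_k \sum_(j < m k) \sum_(c : bool)
                  cconj (K k j c (y k)) * K k j c (z k)).
    rewrite (prod_sum_fprod (T := fun k => 'I_(m k))).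
    apply: eq_bigr => j _; rewrite bigA_distr_bigA; apply: eq_bigr => x _.
    by rewrite cconj_prod -big_split.
  under eq_bigr do rewrite Kc.
  have [->|yz] := eqVneq y z; first by rewrite big1 // => k _; rewrite eqxx.
  have /existsP[k yzk] : [exists k, y k != z k].
    rewrite -negb_forall; apply: contra yz => /forallP h.
    by apply/eqP/ffunP => k; apply/eqP/h.
  by rewrite (bigD1 k) //= (negbTE yzk) mul0r.
transitivity (\sum_(y : bits N) \sum_(z : bits N) cconj (psi y) * w z * (y == z)%:R).
  apply: eq_bigr => y _; rewrite (bigD1 y) //= eqxx mulr1 big1 ?addr0 // => z.
  by rewrite eq_sym => /negbTE->; rewrite mulr0.
under eq_bigr => y _ do under eq_bigr => z _ do rewrite -kernel mulr_sumr.
under eq_bigr => y _ do rewrite exchange_big /=.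
rewrite exchange_big /=; apply: eq_bigr => j _.
under eq_bigr => y _ do under eq_bigr => z _ do rewrite mulr_sumr.
under eq_bigr => y _ do rewrite exchange_big /=.
rewrite exchange_big /=; apply: eq_bigr => x _.
rewrite !ffunE cconj_sum big_distrlr /=; apply: eq_bigr => y _; apply: eq_bigr => z _.
by rewrite cconjM; ring.
Qed.

Lemma inner_scalel (N : nat) (c : C) (psi w : vec N) :
  inner (c *: psi) w = cconj c * inner psi w.
Proof. by rewrite mulr_sumr; apply: eq_bigr => x _; rewrite ffunE cconjM mulrA. Qed.

Lemma inner_scalexx (N : nat) (c : C) (psi : vec N) :
  inner (c *: psi) (c *: psi) = `|c| ^+ 2 * inner psi psi.
Proof.
rewrite !norm2_innerxx mulr_sumr; apply: eq_bigr => x _.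
by rewrite ffunE normrM exprMn.
Qed.

(** Homogeneous in [psi] and in [w], because the branches of a protocol carry unnormalized
    vectors. *)
Definition overlap_le (N : nat) (S : vec N -> Prop) (psi : vec N) (mu : C) : Prop :=
  forall w, S w -> `|inner psi w| ^+ 2 <= mu * inner psi psi * inner w w.

(** Induction on the protocol: [inner_prod_apply] splits the overlap and both norms over the
    outcomes, each branch obeys the bound because [S] is stable under local operators, and
    [cauchy_sum] recombines them. At the end of a branch homogeneity absorbs the scalar. *)
Lemma locc_overlap_le (N : nat) (S : vec N -> Prop) (mu : C) (P : locc N)
    (psi target : vec N) :
    0 <= mu -> (forall ops w, S w -> S (prod_apply ops w)) ->
    locc_valid P -> locc_achieves P psi target ->
  overlap_le S target mu -> overlap_le S psi mu.
Proof.
move=> mu0 Sstable; elim: P psi => [|m K nx IH] psi /=.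
  move=> _ [c ->] ht w Sw; rewrite inner_scalel inner_scalexx normrM exprMn.
  rewrite norm_conjC.
  have -> : mu * (`|c| ^+ 2 * inner target target) * inner w w =
            `|c| ^+ 2 * (mu * inner target target * inner w w) by ring.
  by apply: ler_wpM2l (ht _ Sw); rewrite exprn_ge0.
move=> [Kc nxv] ach ht w Sw.
rewrite (inner_prod_apply psi w Kc) (inner_prod_apply psi psi Kc).
rewrite (inner_prod_apply w w Kc) [mu * _]mulr_sumr.
apply: cauchy_sum => j _; rewrite ?mulr_ge0 ?inner_ge0 //.
by apply: (IH (fun k => j k)) => //; exact: Sstable.
Qed.

(** * Product vectors across a cut *)

(* w is a product vector across the cut (A, ~: A): vanishing of all 2x2 minors. *)
Definition cut_product (N : nat) (A : {set 'I_N}) (w : vec N) : Prop :=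
  forall x y, w x * w y = w (glue A x y) * w (glue A y x).

Lemma glueK (N : nat) (A : {set 'I_N}) (x y : bits N) :
  glue A (glue A x y) (glue A y x) = x.
Proof. by apply/ffunP => k; rewrite !ffunE; case: (k \in A). Qed.

Lemma sum_glue_swap (N : nat) (A : {set 'I_N}) (V : nmodType)
    (F : bits N -> bits N -> V) :
  \sum_x \sum_y F x y = \sum_x \sum_y F (glue A x y) (glue A y x).
Proof.
rewrite !pair_bigA /=.
rewrite (reindex (fun p : bits N * bits N => (glue A p.1 p.2, glue A p.2 p.1))) //=.
by exists (fun p => (glue A p.1 p.2, glue A p.2 p.1)) => -[x y] _ /=; rewrite !glueK.
Qed.

(** Both sides expand to double sums. The weight of a pair of strings is a product over single
    qubits, so exchanging the [A]-parts of the output and of the input strings together leaves it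
    unchanged. *)
Lemma cut_product_prod_apply (N : nat) (A : {set 'I_N}) ops (w : vec N) :
  cut_product A w -> cut_product A (prod_apply ops w).
Proof.
move=> wA x y; rewrite !ffunE !big_distrlr /= [RHS](sum_glue_swap A).
apply: eq_bigr => x' _; apply: eq_bigr => y' _.
rewrite mulrACA wA [RHS]mulrACA; congr (_ * _).
rewrite -!big_split /=; apply: eq_bigr => k _; rewrite !ffunE.
by case: ifP => // _; rewrite mulrC.
Qed.

Lemma cut_product_prodvec (N : nat) (A : {set 'I_N}) (ph : 'I_N -> bool -> C) :
  cut_product A (prodvec ph).
Proof.
move=> x y; rewrite !ffunE -!big_split /=; apply: eq_bigr => k _; rewrite !ffunE.
by case: ifP => // _; rewrite mulrC.
Qed.

(** * Overlaps of embedded states *)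

Definition extend (n N : nat) (f : 'I_n -> 'I_N) (y : bits n) : bits N :=
  [ffun k => [exists i, (f i == k) && y i]].

Lemma extend_f (n N : nat) (f : 'I_n -> 'I_N) (y : bits n) i :
  injective f -> extend f y (f i) = y i.
Proof.
move=> fI; rewrite ffunE; apply/existsP/idP => [[j /andP[/eqP/fI-> //]]|yi].
by exists i; rewrite eqxx.
Qed.

Lemma extend_out (n N : nat) (f : 'I_n -> 'I_N) (y : bits n) k :
  k \notin codom f -> extend f y k = false.
Proof.
move=> kf; rewrite ffunE; apply/existsP => -[i /andP[/eqP e _]].
by rewrite -e codom_f in kf.
Qed.

Lemma sum_extend (n N : nat) (f : 'I_n -> 'I_N) (V : nmodType) (F : bits N -> V) :
    injective f ->
  \sum_(x : bits N | [forall k, (k \notin codom f) ==> ~~ x k]) F x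
    = \sum_(y : bits n) F (extend f y).
Proof.
move=> fI; rewrite (reindex_onto (extend f) (fun x => [ffun i => x (f i)])) /=.
  apply: eq_bigl => y; apply/andP; split.
    by apply/forallP => k; apply/implyP => /(extend_out y)->.
  by apply/eqP/ffunP => i; rewrite ffunE extend_f.
move=> x /forallP xP; apply/ffunP => k.
have [/codomP[i ->]|kf] := boolP (k \in codom f); first by rewrite extend_f ?ffunE.
by rewrite (extend_out _ kf); move: (xP k); rewrite kf /= => /negbTE.
Qed.

Lemma inner_embed (n N : nat) (f : 'I_n -> 'I_N) (phi : vec n) (w : vec N) :
    injective f ->
  inner (embed f phi) w = inner phi [ffun y => w (extend f y)].
Proof.
move=> fI; rewrite /inner; under [RHS]eq_bigr => y _ do rewrite ffunE.
transitivity (\sum_(x : bits N | [forall k, (k \notin codom f) ==> ~~ x k])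
    cconj (phi [ffun i => x (f i)]) * w x).
  rewrite [RHS]big_mkcond /=; apply: eq_bigr => x _; rewrite ffunE.
  by case: ifP => // _; rewrite /cconj rmorph0 mul0r.
rewrite sum_extend //; apply: eq_bigr => y _; congr (cconj (phi _) * _).
by apply/ffunP => i; rewrite ffunE extend_f.
Qed.

Lemma embed_extend (n N : nat) (f : 'I_n -> 'I_N) (phi : vec n) (y : bits n) :
  injective f -> embed f phi (extend f y) = phi y.
Proof.
move=> fI; rewrite ffunE ifT; last first.
  by apply/forallP => k; apply/implyP => /(extend_out y)->.
by congr (phi _); apply/ffunP => i; rewrite ffunE extend_f.
Qed.

(** Restricting [w] to the strings that vanish outside the range of [f] keeps the overlap and the
    product structure, and can only decrease the norm of [w]. *)
Lemma overlap_le_embed (n N : nat) (f : 'I_n -> 'I_N) (A : {set 'I_N})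
    (phi : vec n) (mu : C) :
    injective f -> 0 <= mu ->
    overlap_le (cut_product (f @^-1: A)) phi mu ->
  overlap_le (cut_product A) (embed f phi) mu.
Proof.
move=> fI mu0 hphi w wA; rewrite !inner_embed //.
have -> : [ffun y => embed f phi (extend f y)] = phi.
  by apply/ffunP => y; rewrite ffunE embed_extend.
set w' := [ffun y => w (extend f y)].
have w'A : cut_product (f @^-1: A) w'.
  have ext_glue y z : extend f (glue (f @^-1: A) y z) = glue A (extend f y) (extend f z).
    apply/ffunP => k; rewrite [RHS]ffunE.
    have [/codomP[i ->]|kf] := boolP (k \in codom f); last by rewrite !extend_out ?if_same.
    by rewrite !extend_f // ffunE inE.
  by move=> y z; rewrite !ffunE !ext_glue.
apply: (le_trans (hphi _ w'A)); apply: ler_wpM2l; first by rewrite mulr_ge0 ?inner_ge0.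
rewrite !norm2_innerxx; under eq_bigr => y _ do rewrite ffunE.
rewrite -(sum_extend (fun x => `|w x| ^+ 2)) // [leRHS](bigID
  (fun x : bits N => [forall k, (k \notin codom f) ==> ~~ x k])) /= lerDl.
by rewrite sumr_ge0 // => x _; rewrite exprn_ge0.
Qed.

(** * The reduced density matrix as a quadratic form *)

Lemma restr_subproof (N : nat) (A : {set 'I_N}) (x : bits N) :
  [forall i, (i \notin A) ==> ~~ [ffun i => (i \in A) && x i] i].
Proof. by apply/forallP => i; apply/implyP => /negbTE iA; rewrite ffunE iA. Qed.

Definition restr (N : nat) (A : {set 'I_N}) (x : bits N) : bitsOn A :=
  exist (fun x : bits N => is_true [forall i, (i \notin A) ==> ~~ x i]) _
    (restr_subproof A x).

Lemma glue_restr (N : nat) (A : {set 'I_N}) (x : bits N) :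
  glue A (val (restr A x)) (val (restr (~: A) x)) = x.
Proof. by apply/ffunP => k; rewrite !ffunE inE; case: (k \in A). Qed.

Lemma restr_glue (N : nat) (A : {set 'I_N}) (x y : bits N) :
  (restr A (glue A x y) = restr A x) * (restr (~: A) (glue A x y) = restr (~: A) y).
Proof.
by split; apply: val_inj; apply/ffunP => k; rewrite !ffunE ?inE; case: (k \in A).
Qed.

Lemma restr_val (N : nat) (A : {set 'I_N}) (a : bitsOn A) : restr A (val a) = a.
Proof.
apply: val_inj; apply/ffunP => k; rewrite ffunE.
have /forallP/(_ k) := valP a; case: (k \in A) => //=.
by move/negbTE->.
Qed.

Lemma sum_cut (N : nat) (A : {set 'I_N}) (V : nmodType) (F : bits N -> V) :
  \sum_x F x = \sum_(a : bitsOn A) \sum_(b : bitsOn (~: A)) F (glue A (val a) (val b)).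
Proof.
rewrite pair_bigA /=.
rewrite (reindex (fun p : bitsOn A * bitsOn (~: A) => glue A (val p.1) (val p.2))) //=.
exists (fun x => (restr A x, restr (~: A) x)) => [[a b] _|x _] /=.
  by rewrite !restr_glue !restr_val.
exact: glue_restr.
Qed.

(** The amplitude matrix of [psi] across the cut; [rho A psi] is its product with its adjoint. *)
Definition amp (N : nat) (A : {set 'I_N}) (psi : vec N) (i : 'I_#|{: bitsOn A}|)
    (z : bitsOn (~: A)) : C :=
  psi (glue A (val (enum_val i)) (val z)).

Lemma sum_cut_ord (N : nat) (A : {set 'I_N}) (V : nmodType) (F : bits N -> V) :
  \sum_x F x = \sum_(i < #|{: bitsOn A}|) \sum_(z : bitsOn (~: A))
    F (glue A (val (enum_val i)) (val z)).
Proof.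
by rewrite (sum_cut A) -(big_enum_val (fun a : bitsOn A =>
  \sum_(z : bitsOn (~: A)) F (glue A (val a) (val z)))).
Qed.

Lemma mxtrace_rho (N : nat) (A : {set 'I_N}) (psi : vec N) : \tr (rho A psi) = inner psi psi.
Proof.
rewrite norm2_innerxx (sum_cut_ord A) /mxtrace; apply: eq_bigr => i _.
by rewrite mxE; apply: eq_bigr => z _; rewrite normCK.
Qed.

(** The form is taken with [v] as a row vector on the left, matching the left eigenvectors of
    [eigenvalueP]. *)
Definition rho_form (N : nat) (A : {set 'I_N}) (psi : vec N)
    (v : 'I_#|{: bitsOn A}| -> C) : C :=
  \sum_i \sum_j v i * rho A psi i j * cconj (v j).

Lemma rho_formE (N : nat) (A : {set 'I_N}) (psi : vec N) v :
  rho_form psi v = \sum_(z : bitsOn (~: A)) `|\sum_i v i * amp psi i z| ^+ 2.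
Proof.
under [RHS]eq_bigr => z _ do rewrite normCK rmorph_sum big_distrlr /=.
rewrite [RHS]exchange_big /=; apply: eq_bigr => i _.
rewrite [RHS]exchange_big /=; apply: eq_bigr => j _.
rewrite mxE mulr_sumr mulr_suml; apply: eq_bigr => z _.
by rewrite rmorphM /amp /cconj; ring.
Qed.

Lemma rho_form_ge0 (N : nat) (A : {set 'I_N}) (psi : vec N) v :
  0 <= rho_form (A := A) psi v.
Proof. by rewrite rho_formE sumr_ge0 // => z _; rewrite exprn_ge0. Qed.

(** Let [u] be the row [v] times the amplitude matrix, and Q the value of the form. The product
    vector [w] made of conj(v) and [u] has overlap Q with [psi] and squared norm |v|^2 Q, so the
    hypothesis reads Q^2 <= mu |v|^2 Q. *)
Lemma rho_form_le (N : nat) (A : {set 'I_N}) (psi : vec N) (mu : C) v :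
    0 <= mu -> is_state psi -> overlap_le (cut_product A) psi mu ->
  rho_form (A := A) psi v <= mu * \sum_i `|v i| ^+ 2.
Proof.
move=> mu0 psi1 hpsi; pose u z := \sum_i v i * amp (A := A) psi i z.
pose w : vec N := [ffun x => cconj (v (enum_rank (restr A x))) * u (restr (~: A) x)].
have wE i z : w (glue A (val (enum_val i)) (val z)) = cconj (v i) * u z.
  by rewrite ffunE !restr_glue !restr_val enum_valK.
have wA : cut_product A w by move=> x y; rewrite !ffunE !restr_glue; ring.
have Q0 := rho_form_ge0 (A := A) psi v.
have psiw : inner psi w = rho_form psi v.
  rewrite rho_formE /inner (sum_cut_ord A) exchange_big /=; apply: eq_bigr => z _.
  rewrite normC2 -/(u z) cconj_sum mulr_suml; apply: eq_bigr => i _.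
  by rewrite wE cconjM /amp; ring.
have ww : inner w w = (\sum_i `|v i| ^+ 2) * rho_form psi v.
  rewrite norm2_innerxx (sum_cut_ord A) rho_formE mulr_suml; apply: eq_bigr => i _.
  rewrite mulr_sumr; apply: eq_bigr => z _.
  by rewrite wE normrM exprMn norm_conjC.
have := hpsi _ wA; rewrite psiw ww psi1 mulr1 mulrA ger0_norm //.
(* Dividing by the form requires that it is positive; if it vanishes, the bound is trivial. *)
move: Q0; rewrite le_eqVlt => /predU1P[<- _|Qp].
  by rewrite mulr_ge0 // sumr_ge0 // => i _; rewrite exprn_ge0.
by rewrite expr2 ler_pM2r.
Qed.

(** * Spectrum, entropy and rank across a cut *)

Lemma eigs_normal (m : nat) (M : 'M[C]_m) :
  char_poly M = \prod_(l <- eigs M) ('X - l%:P).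
Proof.
rewrite /eigs; case: closed_field_poly_normal => s /= {1}->.
by rewrite (monicP (char_poly_monic M)) scale1r.
Qed.

(** The trace is read off the second highest coefficient of the characteristic polynomial, which
    exists in positive dimension. *)
Lemma sum_eigs (m : nat) (M : 'M[C]_m) : (0 < m)%N -> \sum_(l <- eigs M) l = \tr M.
Proof.
move=> m0; have sz : size (eigs M) = m.
  by apply: succn_inj; rewrite -(size_char_poly M) eigs_normal size_prod_XsubC.
apply: oppr_inj; rewrite -(char_poly_trace M m0) eigs_normal -coefPn_prod_XsubC ?sz //.
by rewrite -lt0n.
Qed.

Lemma card_bitsOn_gt0 (N : nat) (A : {set 'I_N}) : (0 < #|{: bitsOn A}|)%N.
Proof. by apply/card_gt0P; exists (restr A [ffun => false]). Qed.

(** At an eigenvector [v] the quadratic form takes the value l |v|^2, which lies between 0 and mu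
    |v|^2. *)
Lemma eigs_rho_bound (N : nat) (A : {set 'I_N}) (psi : vec N) (mu l : C) :
    0 <= mu -> is_state psi -> overlap_le (cut_product A) psi mu ->
  l \in eigs (rho A psi) -> 0 <= l <= mu.
Proof.
move=> mu0 psi1 hpsi; rewrite -root_prod_XsubC -eigs_normal -eigenvalue_root_char.
case/eigenvalueP => v vl v0.
have formE : rho_form psi (v 0) = l * \sum_i `|v 0 i| ^+ 2.
  rewrite /rho_form exchange_big mulr_sumr /=; apply: eq_bigr => j _.
  have := congr1 (fun u : 'rV_ _ => u 0 j) vl; rewrite !mxE => e.
  by rewrite -mulr_suml e normCK mulrA.
have v2 : 0 < \sum_i `|v 0 i| ^+ 2.
  rewrite lt_neqAle sumr_ge0 ?andbT => [|i _]; last by rewrite exprn_ge0.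
  rewrite eq_sym psumr_neq0 => [|i _]; last by rewrite exprn_ge0.
  have [i vi] : exists i, v 0 i != 0.
    apply/existsP; rewrite -negb_forall; apply: contra v0 => /forallP h.
    by apply/eqP/rowP => i; rewrite mxE; apply/eqP/h.
  by apply/hasP; exists i; rewrite ?mem_index_enum //= exprn_gt0 // normr_gt0.
have := rho_form_ge0 psi (v 0); rewrite formE pmulr_lge0 // => -> /=.
by have := rho_form_le (v 0) mu0 psi1 hpsi; rewrite formE ler_pM2r.
Qed.

Lemma half_exprC (r : nat) : (2^-1 : C) ^+ r = (((2^-1 : R) ^+ r)%:C)%C.
Proof. by rewrite rmorphXn fmorphV rmorph_nat. Qed.

Lemma half_exprC_ge0 (r : nat) : 0 <= (2^-1 : C) ^+ r.
Proof. by rewrite exprn_ge0 // invr_ge0 ler0n. Qed.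

Lemma ln2_gt0 : 0 < ln (2 : R).
Proof. by rewrite ln_gt0 // ltr1n. Qed.

Lemma log2_half (r : nat) : log2 ((2^-1) ^+ r) = - r%:R.
Proof.
rewrite /log2 lnXn ?invr_gt0 // lnV ?posrE // mulNrn mulNr; congr (- _).
by rewrite -[ln 2 *+ r]mulr_natl mulfK // gt_eqF // ln2_gt0.
Qed.

Lemma ler_log2 (x y : R) : 0 < x -> x <= y -> log2 x <= log2 y.
Proof.
move=> x0 xy; rewrite /log2 ler_pM2r ?invr_gt0 ?ln2_gt0 // ler_ln //.
by rewrite posrE (lt_le_trans x0).
Qed.

Lemma log2_pow2 (r : nat) : log2 (2 ^+ r) = r%:R.
Proof.
by rewrite /log2 lnXn // -[ln 2 *+ r]mulr_natl mulfK // gt_eqF // ln2_gt0.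
Qed.

(** All eigenvalues are at most 2^-r, so each -log2 l is at least r; the entropy averages these
    numbers with weights l of sum 1. *)
Lemma entropy_ge (N : nat) (A : {set 'I_N}) (psi : vec N) (r : nat) :
    is_state psi -> overlap_le (cut_product A) psi (2^-1 ^+ r) ->
  r%:R <= entropy A psi.
Proof.
move=> psi1 hpsi.
have eigP l : l \in eigs (rho A psi) -> 0 <= complex.Re l <= (2^-1) ^+ r.
  move=> /(eigs_rho_bound (half_exprC_ge0 r) psi1 hpsi).
  by rewrite half_exprC !lecE /= => /andP[/andP[_ ->] /andP[_ ->]].
have sumRe : \sum_(l <- eigs (rho A psi)) complex.Re l = 1.
  have := sum_eigs (rho A psi) (card_bitsOn_gt0 A).
  rewrite mxtrace_rho psi1 => /(congr1 (@complex.Re _)) /= <-.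
  by rewrite raddf_sum.
rewrite /entropy lerNr -[leRHS]mulr1 -[X in _ <= _ * X]sumRe mulr_sumr big_seq [leRHS]big_seq.
apply: ler_sum => l /eigP/andP[l0 lr]; rewrite /xlog2x.
case: eqP => [->|/eqP ln0]; first by rewrite mulr0.
rewrite mulrC ler_wpM2r // -log2_half ler_log2 //.
by rewrite lt_neqAle eq_sym ln0.
Qed.

Local Open Scope sesquilinear_scope.

(** In an orthonormal basis [U] of its row space the density matrix still has trace 1. This trace
    has only [\rank M] diagonal entries, each a value of the form at a unit vector and hence at most
    2^-r. *)
Lemma mxrank_rho_ge (N : nat) (A : {set 'I_N}) (psi : vec N) (r : nat) :
    is_state psi -> overlap_le (cut_product A) psi (2^-1 ^+ r) ->
  (2 ^ r <= \rank (rho A psi))%N.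
Proof.
move=> psi1 hpsi; set M := rho A psi; pose U := schmidt (row_base M).
have Uu : U \is unitarymx by rewrite schmidt_unitarymx // rank_leq_row.
have /submxP[D MU] : (M <= U)%MS by rewrite -(eq_row_base M) schmidt_sub.
have MUU : M *m U^t* *m U = M.
  have e : D *m U *m U^t* *m U = D *m U by rewrite mulmxtVK.
  by rewrite -MU in e.
have tr1 : \tr (U *m M *m U^t*) = 1.
  by rewrite -mulmxA mxtrace_mulC MUU mxtrace_rho psi1.
have : (1 : C) <= (2^-1) ^+ r * (\rank M)%:R.
  have -> : (\rank M)%:R = \sum_(i < \rank M) (1 : C) by rewrite sumr_const card_ord.
  rewrite -[leLHS]tr1 /mxtrace mulr_sumr.
  apply: ler_sum => i _; rewrite mulr1.
  have -> : (U *m M *m U^t*) i i = rho_form psi (U i).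
    rewrite !mxE /rho_form exchange_big /=; apply: eq_bigr => j _.
    by rewrite !mxE mulr_suml.
  apply: (le_trans (rho_form_le (U i) (half_exprC_ge0 r) psi1 hpsi)).
  have -> : \sum_j `|U i j| ^+ 2 = 1.
    have := congr1 (fun u : 'M_ _ => u i i) (unitarymxP Uu); rewrite !mxE eqxx => e.
    by apply: etrans e; apply: eq_bigr => j _; rewrite !mxE normCK.
  by rewrite mulr1.
rewrite exprVn mulrC ler_pdivlMr ?exprn_gt0 // mul1r -natrX ler_nat.
by [].
Qed.

Lemma logrank_ge (N : nat) (A : {set 'I_N}) (psi : vec N) (r : nat) :
    is_state psi -> overlap_le (cut_product A) psi (2^-1 ^+ r) ->
  r%:R <= logrank A psi.
Proof.
move=> psi1 hpsi; rewrite -log2_pow2 ler_log2 ?exprn_gt0 //.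
by rewrite -natrX ler_nat mxrank_rho_ge.
Qed.

(** * The Schmidt measure and the geometric measure *)

(** Each product vector splits into a factor on [A] and a factor on the complement, so the density
    matrix factors through a space of dimension [K]. *)
Lemma prodvec_cut_rank (N : nat) (A : {set 'I_N}) (K : nat)
    (phs : 'I_K -> 'I_N -> bool -> C) (a : 'I_K -> C) :
  (\rank (rho A (\sum_(j < K) a j *: prodvec (phs j)))%R <= K)%N.
Proof.
set psi := \sum_(j < K) _.
pose L : 'M[C]_(_, K) := \matrix_(i < #|{: bitsOn A}|, j < K)
  (a j * \prod_(k in A) phs j k (val (enum_val i) k)).
pose X : 'M[C]_(K, _) := \matrix_(j < K, i < #|{: bitsOn A}|)
  \sum_(z : bitsOn (~: A)) (\prod_(k | k \notin A) phs j k (val z k)) * cconj (amp psi i z).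
suff -> : rho A psi = L *m X.
  by rewrite (leq_trans (mxrankM_maxl _ _)) // rank_leq_col.
apply/matrixP => i i'; rewrite !mxE.
under [RHS]eq_bigr => j _ do rewrite !mxE mulr_sumr.
rewrite exchange_big /=; apply: eq_bigr => z _; rewrite -/(amp psi i' z).
under [RHS]eq_bigr => j _ do rewrite mulrA; rewrite -mulr_suml; congr (_ * _).
rewrite /psi sum_ffunE; apply: eq_bigr => j _; rewrite !ffunE -mulrA.
congr (_ * _); rewrite (bigID (mem A)) /=; congr (_ * _); apply: eq_bigr => k kA.
  by rewrite ffunE kA.
by rewrite ffunE (negbTE kA).
Qed.

Definition basis_qubit (b : bool) : bool -> C := fun c => (c == b)%:R.

Lemma unit_basis_qubit b : unit_qubit (basis_qubit b).
Proof.
by case: b; rewrite /unit_qubit /basis_qubit /cconj /= rmorph0 rmorph1 ?mulr1 ?mul0r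
  ?addr0 ?add0r.
Qed.

Lemma prodvec_basis (N : nat) (x y : bits N) :
  prodvec (fun k => basis_qubit (x k)) y = (y == x)%:R.
Proof.
rewrite ffunE /basis_qubit; have [->|yx] := eqVneq y x.
  by rewrite big1 // => k _; rewrite eqxx.
have /existsP[k yxk] : [exists k, y k != x k].
  rewrite -negb_forall; apply: contra yx => /forallP h.
  by apply/eqP/ffunP => k; apply/eqP/h.
by rewrite (bigD1 k) //= (negbTE yxk) mul0r.
Qed.

Lemma Es_ge (N : nat) (A : {set 'I_N}) (psi : vec N) (r : nat) :
    is_state psi -> overlap_le (cut_product A) psi (2^-1 ^+ r) ->
  r%:R <= Es psi.
Proof.
move=> psi1 hpsi; rewrite -log2_pow2 ler_log2 ?exprn_gt0 // lb_le_inf //; last first.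
  move=> _ [K [-> [phs [_ [a psiE]]]]]; rewrite -natrX ler_nat.
  apply: (leq_trans (mxrank_rho_ge psi1 hpsi)); rewrite psiE; exact: prodvec_cut_rank.
(* The infimum has to range over a non-empty set: the expansion in the computational basis belongs
   to it. *)
exists #|{: bits N}|%:R; exists #|{: bits N}|; split => //.
exists (fun j k => basis_qubit ((enum_val j : bits N) k)); split.
  by move=> j k; exact: unit_basis_qubit.
exists (fun j => psi (enum_val j)).
rewrite -(big_enum_val (fun x : bits N => psi x *: prodvec (fun k => basis_qubit (x k)))) /=.
apply/ffunP => y; rewrite sum_ffunE (bigD1 y) //= ffunE prodvec_basis eqxx.
rewrite [_ *: _]mulr1 big1 ?addr0 // => x.
by rewrite eq_sym ffunE prodvec_basis => /negbTE->; rewrite [_ *: _]mulr0.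
Qed.

Lemma abs2E (z : C) : ((abs2 z)%:C)%C = `|z| ^+ 2.
Proof.
rewrite /abs2 -normCK; have : `|z| ^+ 2 \is Num.real by rewrite rpredX ?normr_real.
by move=> ?; rewrite RRe_real.
Qed.

Lemma inner_prodvec_unit (N : nat) (ph : 'I_N -> bool -> C) :
  (forall k, unit_qubit (ph k)) -> inner (prodvec ph) (prodvec ph) = 1.
Proof.
move=> phu; rewrite /inner.
under eq_bigr => x _ do rewrite !ffunE cconj_prod -big_split /=.
rewrite -(bigA_distr_bigA (fun k b => cconj (ph k b) * ph k b)) /= big1 // => k _.
by rewrite big_bool /= addrC phu.
Qed.

Lemma Eg_ge (N : nat) (A : {set 'I_N}) (psi : vec N) (r : nat) :
    is_state psi -> overlap_le (cut_product A) psi (2^-1 ^+ r) ->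
  r%:R <= Eg psi.
Proof.
move=> psi1 hpsi; rewrite /Eg; set E := (X in sup X).
have Eub : ubound E ((2^-1) ^+ r).
  move=> _ [ph [phu ->]].
  have := hpsi _ (cut_product_prodvec A ph).
  by rewrite psi1 inner_prodvec_unit // !mulr1 -abs2E half_exprC lecR.
(* Monotonicity of [log2] asks for a positive supremum; a basis string with non-zero amplitude
   provides a positive overlap. *)
have [x psix] : exists x, psi x != 0.
  apply/existsP; rewrite -negb_forall; apply/negP => /forallP h.
  have psi0 : inner psi psi = 0.
    by rewrite norm2_innerxx big1 // => x _; rewrite (eqP (h x)) normr0 expr0n.
  by move: psi0; rewrite psi1 => /eqP; rewrite oner_eq0.
pose e := abs2 (inner psi (prodvec (fun k => basis_qubit (x k)))).
have Ee : E e.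
  exists (fun k => basis_qubit (x k)); split => // k; exact: unit_basis_qubit.
have e0 : 0 < e.
  rewrite -(ltcR _ e) abs2E exprn_gt0 // normr_gt0 /inner (bigD1 x) //= prodvec_basis.
  rewrite eqxx mulr1 big1 ?addr0 ?conjC_eq0 // => y /negbTE yx.
  by rewrite prodvec_basis yx mulr0.
rewrite lerNr -log2_half ler_log2 //.
  by apply: (lt_le_trans e0); apply: ub_le_sup => //; exists ((2^-1) ^+ r).
by apply: ge_sup => //; exists e.
Qed.

(** * Graph states and their circuits *)

Definition had_coef : C := (sqrtC 2)^-1.

Definition hadamard : qop := fun a b => had_coef * (-1) ^+ (a && b).

Definition cz (a b : bool * bool) : C := (a == b)%:R * (-1) ^+ (a.1 && a.2).

Lemma had_coef_ge0 : 0 <= had_coef.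
Proof. by rewrite invr_ge0 sqrtC_ge0 ler0n. Qed.

Lemma had_coef2 : had_coef ^+ 2 = 2^-1.
Proof. by rewrite exprVn sqrtCK. Qed.

Lemma cconj_had_coef : cconj had_coef = had_coef.
Proof. by apply: conj_Creal; rewrite ger0_real ?had_coef_ge0. Qed.

Lemma cconj_sign (b : bool) : cconj ((-1) ^+ b) = (-1) ^+ b.
Proof. by apply: conj_Creal; rewrite rpredX // rpredN rpred1. Qed.

Lemma unitary_hadamard : unitary1 hadamard.
Proof.
move=> a b; rewrite big_bool /= /hadamard !cconjM cconj_had_coef !cconj_sign.
have e (u v : C) : had_coef * u * (had_coef * v) = 2^-1 * (u * v).
  by rewrite -had_coef2; ring.
rewrite !e -mulrDr -!signr_addb; case: a; case: b => /=.
- by rewrite -mulr2n mulVf // pnatr_eq0.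
- by rewrite expr1 expr0 addNr mulr0.
- by rewrite expr1 expr0 addNr mulr0.
- by rewrite -mulr2n mulVf // pnatr_eq0.
Qed.

Lemma unitary_cz : unitary2 cz.
Proof.
move=> a b; rewrite (bigD1 a) //= big1 ?addr0 => [|c /negbTE ca].
  rewrite /cz eqxx mul1r cconj_sign; have [->|_] := eqVneq a b; last by rewrite mul0r mulr0.
  by rewrite mul1r -signr_addb addbb.
by rewrite /cz ca mul0r /cconj rmorph0 mul0r.
Qed.

Definition graph_circuit (adj : rel nat) (n : nat) : seq (gate n) :=
  [seq G1 i hadamard | i <- enum 'I_n] ++
  [seq G2 p.1 p.2 cz
    | p <- enum [pred p : 'I_n * 'I_n | (p.1 < p.2)%N && adj p.1 p.2]].

Definition graph_state (adj : rel nat) (n : nat) : vec n :=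
  run_circuit (graph_circuit adj n).

Definition graph_sign (adj : rel nat) (n : nat) (x : bits n) : C :=
  \prod_(p : 'I_n * 'I_n | (p.1 < p.2)%N && adj p.1 p.2) (-1) ^+ (x p.1 && x p.2).

Lemma graph_circuit_valid (adj : rel nat) (n : nat) g :
  List.In g (graph_circuit adj n) -> gate_valid g.
Proof.
move=> /List.in_app_iff[] /List.in_map_iff[p [<-]] /= => [_|pin].
  exact: unitary_hadamard.
split; last exact: unitary_cz.
have : p \in enum [pred p : 'I_n * 'I_n | (p.1 < p.2)%N && adj p.1 p.2].
  by elim: (enum _) pin => //= a l IH [->|/IH]; rewrite inE ?eqxx // => ->; rewrite orbT.
by rewrite mem_enum inE => /andP[lt _]; apply: contraTneq lt => ->; rewrite ltnn.
Qed.

Lemma size_graph_circuit (adj : rel nat) (n : nat) :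
  (size (graph_circuit adj n) <= n + n * n)%N.
Proof.
rewrite /graph_circuit size_cat 2!size_map size_enum_ord -cardE leq_add2l.
by apply: (leq_trans (max_card _)); rewrite card_prod card_ord.
Qed.

Lemma graph_state_preparable (adj : nat -> rel nat) :
  poly_preparable (fun n => graph_state (adj n) n).
Proof.
exists (fun n => graph_circuit (adj n) n); split.
  exists 2 => n; apply: (leq_trans (size_graph_circuit _ _)); lia.
by move=> n _; split=> // g; exact: graph_circuit_valid.
Qed.

(** Invariant for the list [l] of gates already applied: qubits in [l] are in the plus state, all
    others still in the zero state. *)
Lemma run_hadamards (n : nat) (l : seq 'I_n) : uniq l ->
  foldl (fun psi g => apply_gate g psi) (zero_state n) [seq G1 i hadamard | i <- l]
  = [ffun x : bits n => had_coef ^+ size l * [forall k, (k \notin l) ==> ~~ x k]%:R].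
Proof.
elim/last_ind: l => [_|l i IH].
  apply/ffunP => x; rewrite !ffunE mul1r; congr (_%:R); congr nat_of_bool.
  apply/eqP/forallP => [-> k|h]; first by rewrite ffunE.
  by apply/ffunP => k; rewrite ffunE; apply/negbTE/h.
rewrite rcons_uniq => /andP[il lu]; rewrite map_rcons foldl_rcons IH //=.
apply/ffunP => x; rewrite !ffunE big_bool !ffunE size_rcons.
(* Before its gate, qubit [i] is zero, so only the input bit 0 contributes. *)
have -> : [forall k, (k \notin l) ==> ~~ upd x i true k] = false.
  by apply/negbTE/forallPn; exists i; rewrite ffunE eqxx il.
rewrite mulr0n !mulr0 /= add0r /hadamard andbF mulr1 exprS mulrA; congr (_ * _%:R).
congr nat_of_bool; apply: eq_forallb => k; rewrite ffunE mem_rcons inE.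
by have [->|] := eqVneq k i; rewrite ?implybT.
Qed.

Lemma run_czs (n : nat) (l : seq ('I_n * 'I_n)) (psi : vec n) :
  foldl (fun psi g => apply_gate g psi) psi [seq G2 p.1 p.2 cz | p <- l]
  = [ffun x : bits n => psi x * \prod_(p <- l) (-1) ^+ (x p.1 && x p.2)].
Proof.
elim: l psi => [|[i j] l IH] psi /=.
  by apply/ffunP => x; rewrite ffunE big_nil mulr1.
rewrite IH; apply/ffunP => x; rewrite !ffunE big_cons /= mulrA; congr (_ * _).
rewrite (bigD1 (x i, x j)) //= big1 ?addr0; last first.
  by move=> bc /negbTE h; rewrite /cz eq_sym h !mul0r.
rewrite /cz eqxx mul1r mulrC; congr (psi _ * _).
apply/ffunP => k; rewrite !ffunE.
by have [->|_] := eqVneq k j; [|have [->|] := eqVneq k i].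
Qed.

Lemma graph_stateE (adj : rel nat) (n : nat) (x : bits n) :
  graph_state adj n x = had_coef ^+ n * graph_sign adj x.
Proof.
rewrite /graph_state /run_circuit foldl_cat run_hadamards ?enum_uniq // run_czs ffunE.
rewrite big_enum ffunE size_enum_ord /=.
have -> : [forall k, (k \notin enum 'I_n) ==> ~~ x k].
  by apply/forallP => k; rewrite mem_enum.
by rewrite mulr1.
Qed.

Lemma graph_sign_sq (adj : rel nat) (n : nat) (x : bits n) :
  graph_sign adj x ^+ 2 = 1.
Proof. by rewrite -prodrXl big1 // => p _; rewrite sqrr_sign. Qed.

Lemma cconj_graph_sign (adj : rel nat) (n : nat) (x : bits n) :
  cconj (graph_sign adj x) = graph_sign adj x.
Proof. by rewrite cconj_prod; apply: eq_bigr => p _; rewrite cconj_sign. Qed.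

Lemma graph_state_is_state (adj : rel nat) (n : nat) : is_state (graph_state adj n).
Proof.
rewrite /is_state norm2_innerxx.
under eq_bigr => x _.
  rewrite graph_stateE normrM exprMn ger0_norm ?exprn_ge0 ?had_coef_ge0 //.
  rewrite -exprM mulnC exprM had_coef2 -normrX graph_sign_sq normr1 mulr1.
  over.
rewrite sumr_const card_ffun card_bool card_ord -[_ *+ (_ ^ _)]mulr_natr natrX -exprMn.
rewrite mulVf ?expr1n //.
by rewrite pnatr_eq0.
Qed.

(** * Overlaps of graph states with product vectors across a cut *)

Definition flip (n : nat) (x : bits n) (s : 'I_n) : bits n := upd x s (~~ x s).

(** Only edges at [s] change their factor, each by the bit at its other end. The guard [t != s]
    excludes loops, which [graph_sign] ignores. *)
Lemma graph_sign_flip (adj : rel nat) (n : nat) (x : bits n) (s : 'I_n) :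
    symmetric adj ->
  graph_sign adj (flip x s)
  = graph_sign adj x * \prod_(t : 'I_n | (t != s) && adj s t) (-1) ^+ (x t).
Proof.
move=> sym_adj; pose P (i j : 'I_n) := (i < j)%N && adj i j.
have step p : P p.1 p.2 -> (-1) ^+ (flip x s p.1 && flip x s p.2) =
    (-1) ^+ (x p.1 && x p.2) * (if p.1 == s then (-1) ^+ (x p.2) else 1)
    * (if p.2 == s then (-1) ^+ (x p.1) else 1) :> C.
  case: p => i j /= /andP[ij _]; rewrite !ffunE.
  have [ei|_] := eqVneq i s; have [ej|_] := eqVneq j s.
  - by move: ij; rewrite ei ej ltnn.
  - by rewrite ei mulr1 -signr_addb; case: (x s); case: (x j).
  - by rewrite ej mulr1 -signr_addb; case: (x s); case: (x i).
  - by rewrite !mulr1.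
rewrite /graph_sign (eq_bigr _ step) big_split /= big_split /= -mulrA; congr (_ * _).
rewrite -(pair_big_dep xpredT P (fun i j => if i == s then (-1) ^+ x j else 1)) /=.
rewrite -(pair_big_dep xpredT P (fun i j => if j == s then (-1) ^+ x i else 1)) /=.
rewrite (bigD1 s) //= [X in _ * X * _]big1 ?mulr1; last first.
  by move=> i /negbTE ->; rewrite big1.
under eq_bigr do rewrite eqxx.
(* Neighbours above [s] come from pairs with [s] in first place, those below from pairs with [s] in
   second place. *)
rewrite [RHS](bigID (fun t : 'I_n => (s < t)%N)) /=; congr (_ * _).
  apply: eq_bigl => t; rewrite /P; case: ltnP => st; rewrite ?andbF ?andbT //=.
  by rewrite -(inj_eq val_inj) gtn_eqF.
rewrite [RHS]big_mkcond /=; apply: eq_bigr => i _.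
have -> : ((i != s) && adj s i && ~~ (s < i)%N) = P i s.
  rewrite /P sym_adj -leqNgt ltn_neqAle (inj_eq val_inj).
  by case: (i == s); case: (adj _ _); rewrite //= ?andbT ?andbF.
rewrite big_mkcond (bigD1 s) //= eqxx big1 ?mulr1 // => j /negbTE->.
by rewrite if_same.
Qed.

(** The part of the sign change under a flip of [s] that is due to neighbours outside [S]. *)
Definition out_sign (adj : rel nat) (n : nat) (S : {set 'I_n}) (s : 'I_n) (y : bits n) : C :=
  \prod_(t : 'I_n | (t \notin S) && adj s t) (-1) ^+ (y t).

Lemma out_sign_sq (adj : rel nat) (n : nat) (S : {set 'I_n}) s (y : bits n) :
  out_sign adj S s y ^+ 2 = 1.
Proof. by rewrite -prodrXl big1 // => p _; rewrite sqrr_sign. Qed.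

Lemma graph_sign_glue_flip (adj : rel nat) (n : nat) (S : {set 'I_n}) (s : 'I_n)
    (x y : bits n) :
    symmetric adj -> s \in S ->
  graph_sign adj (glue S (flip x s) y) = graph_sign adj (glue S x y)
    * (\prod_(t : 'I_n | (t != s) && adj s t && (t \in S)) (-1) ^+ (x t))
    * out_sign adj S s y.
Proof.
move=> sym_adj sS.
have -> : glue S (flip x s) y = flip (glue S x y) s.
  apply/ffunP => k; rewrite !ffunE; have [->|_] := eqVneq k s; last by case: ifP.
  by rewrite sS.
rewrite graph_sign_flip // -mulrA; congr (_ * _).
rewrite (bigID (mem S)) /=; congr (_ * _).
  by apply: eq_bigr => t /andP[_ tS]; rewrite ffunE tS.
rewrite /out_sign; apply: eq_big => [t|t /andP[_ /negbTE tS]]; last by rewrite ffunE tS.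
case tS: (t \in S); rewrite ?andbF ?andbT //=.
by have [ts|] := eqVneq t s; rewrite // ts sS in tS.
Qed.

Lemma flipK (n : nat) (s : 'I_n) : involutive (fun x : bits n => flip x s).
Proof.
move=> x; apply/ffunP => k; rewrite !ffunE; case: eqP => // ->.
by rewrite eqxx negbK.
Qed.

(** Flipping bit [s] of [x] multiplies each term by -1: the signs from inside [S] occur twice and
    cancel, the two outer signs differ. So the sum equals its own negative. *)
Lemma glue_sign_cancel (adj : rel nat) (n : nat) (S : {set 'I_n}) (s : 'I_n)
    (y y' : bits n) :
    symmetric adj -> s \in S -> out_sign adj S s y != out_sign adj S s y' ->
  \sum_x graph_sign adj (glue S x y) * graph_sign adj (glue S x y') = 0.
Proof.
move=> sym_adj sS yy'.
have prodN1 : out_sign adj S s y * out_sign adj S s y' = -1.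
  have /eqP := out_sign_sq adj S s y; have /eqP := out_sign_sq adj S s y'.
  rewrite !sqrf_eq1; move: yy' => /[swap] /orP[]/eqP-> /[swap] /orP[]/eqP->;
    by rewrite ?eqxx ?mulr1 ?mul1r ?mulrN ?mulNr ?opprK ?mulr1.
set E := \sum_x _.
suff EN : E = - E.
  have : E *+ 2 = 0 by rewrite mulr2n {2}EN subrr.
  by move/eqP; rewrite mulrn_eq0 /= => /eqP.
rewrite {1}/E (reindex_inj (inv_inj (flipK s))) /= -sumrN; apply: eq_bigr => x _.
rewrite !graph_sign_glue_flip //; set X := \prod_(t | _) _.
have X2 : X * X = 1 by rewrite -expr2 /X -prodrXl big1 // => t _; rewrite sqrr_sign.
set g := graph_sign _ _; set g' := graph_sign _ _; set o := out_sign _ _ _ y.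
set o' := out_sign _ _ _ y' in prodN1 *.
have -> : g * X * o * (g' * X * o') = g * g' * (X * X) * (o * o') by ring.
by rewrite X2 prodN1 mulr1 mulrN1.
Qed.

(** Within a class the bit at [t l] is determined by the bits off the matched endpoints, since [s l]
    is adjacent to [t l] and to no other endpoint [t l']. Each matching edge thus halves the
    class. *)
Lemma card_out_sign_class (adj : rel nat) (n : nat) (S : {set 'I_n})
    (J : finType) (L : {set J}) (s t : J -> 'I_n) (y : bits n) :
    (forall l, l \in L -> t l \notin S) ->
    (forall l l', l \in L -> l' \in L -> adj (s l) (t l') = (l == l')) ->
  (#|[set y' : bits n | [forall l in L,
       out_sign adj S (s l) y == out_sign adj S (s l) y']]| * 2 ^ #|L| <= 2 ^ n)%N.
Proof.
move=> tS adjst; set E := finset _; pose D := t @: L.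
have cardD : #|D| = #|L|.
  apply: card_in_imset => l l' lL l'L tt'; apply/eqP.
  by rewrite -(adjst _ _ lL l'L) -tt' adjst // eqxx.
(* Erasing the bits at the matched endpoints is injective on the class and leaves strings supported
   off [D]. *)
pose z (y' : bits n) : bits n := [ffun k => (k \notin D) && y' k].
have zI : {in E &, injective z}.
  move=> y1 y2; rewrite !inE => /forallP y1E /forallP y2E zz.
  have out k : k \notin D -> y1 k = y2 k.
    by move=> kD; have := congr1 (fun u : bits n => u k) zz; rewrite !ffunE kD.
  apply/ffunP => k; have [/imsetP[l lL ->]|/out //] := boolP (k \in D).
  have := y1E l; rewrite lL /= => /eqP e1; have := y2E l; rewrite lL /= => /eqP e2.
  move: (etrans (esym e1) e2); rewrite /out_sign (bigD1 (t l)) /=; last first.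
    by rewrite tS // adjst // eqxx.
  rewrite [X in _ = X -> _](bigD1 (t l)) /=; last by rewrite tS // adjst // eqxx.
  rewrite (eq_bigr (fun k => (-1) ^+ y2 k)); last first.
    move=> k' /andP[/andP[_ adjk] k'l]; rewrite out //.
    apply: contra k'l => /imsetP[l' l'L k'E].
    by move: adjk; rewrite k'E adjst // => /eqP->.
  set X := \prod_(k | _) _.
  have X2 : X * X = 1 by rewrite -expr2 /X -prodrXl big1 // => k' _; rewrite sqrr_sign.
  move=> /(congr1 (fun u => u * X)); rewrite -!mulrA X2 !mulr1.
  case: (y1 (t l)); case: (y2 (t l)) => //= /eqP; rewrite ?expr0 ?expr1.
    by rewrite -subr_eq0 -opprD oppr_eq0 -[1 + 1]/(2%:R) pnatr_eq0.
  by rewrite -addr_eq0 -[1 + 1]/(2%:R) pnatr_eq0.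
rewrite -(card_in_imset zI) -cardD.
have /subset_leq_card : z @: E \subset pffun_on false (~: D) predT.
  apply/fintype.subsetP => _ /imsetP[y' _ ->]; apply/pffun_onP; split=> //.
  by apply/fintype.subsetP => k; rewrite !inE ffunE; case: (k \in D).
rewrite card_pffun_on card_bool => le1.
rewrite -[X in (_ <= _ ^ X)%N](card_ord n) -(cardsC D) addnC expnD leq_mul2r.
by rewrite le1 orbT.
Qed.

Lemma sum_const_bits (n : nat) (c : C) : \sum_(x : bits n) c = 2 ^+ n * c.
Proof. by rewrite sumr_const card_ffun card_bool card_ord -natrX mulr_natl. Qed.

(** Vanishing minors mean rank at most one: a non-zero entry [w x0] serves as pivot, and its column
    and row give the factors. *)
Lemma cut_product_factor (n : nat) (S : {set 'I_n}) (w : vec n) :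
    cut_product S w ->
  exists a b : bits n -> C, forall x y, w (glue S x y) = a x * b y.
Proof.
move=> wS; have [/existsP[x0 wx0]|] := boolP [exists x, w x != 0]; last first.
  rewrite negb_exists => /forallP w0; exists (fun=> 0), (fun=> 0) => x y.
  by rewrite mul0r; apply/eqP/negbNE/w0.
exists (fun x => w (glue S x x0)), (fun y => w (glue S x0 y) / w x0) => x y.
apply: (mulIf wx0); rewrite mulrA mulfVK // wS.
by congr (w _ * w _); apply/ffunP => k; rewrite !ffunE; case: (k \in S).
Qed.

(** A bound on the operator norm of the sign matrix. Its Gram matrix [G] vanishes between different
    classes, has entries of modulus at most 2^n, and a class has at most 2^n / 2^|L| elements. *)
Lemma signed_sum_bound (adj : rel nat) (n : nat) (S : {set 'I_n})
    (J : finType) (L : {set J}) (s t : J -> 'I_n) (b : bits n -> C) :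
    symmetric adj ->
    (forall l, l \in L -> s l \in S) -> (forall l, l \in L -> t l \notin S) ->
    (forall l l', l \in L -> l' \in L -> adj (s l) (t l') = (l == l')) ->
  (\sum_x `|\sum_y graph_sign adj (glue S x y) * b y| ^+ 2) * 2 ^+ #|L|
    <= 2 ^+ n * 2 ^+ n * \sum_y `|b y| ^+ 2.
Proof.
move=> sym_adj sS tS adjst.
pose E (y y' : bits n) :=
  [forall l in L, out_sign adj S (s l) y == out_sign adj S (s l) y'].
have Esym y y' : E y y' = E y' y by apply: eq_forallb => l; rewrite eq_sym.
pose G (y y' : bits n) : C :=
  \sum_x graph_sign adj (glue S x y) * graph_sign adj (glue S x y').
have normsign x : `|graph_sign adj x| = 1 :> C.
  apply/eqP; rewrite -(@eqrXn2 _ 2) // expr1n -normrX graph_sign_sq normr1 //.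
have normG y y' : `|G y y'| <= (E y y')%:R * 2 ^+ n.
  case: (boolP (E y y')) => [_|/forallPn[l]]; last first.
    by rewrite negb_imply => /andP[lL /(glue_sign_cancel sym_adj (sS l lL)) e];
       rewrite /G e normr0 mul0r.
  rewrite mul1r; apply: (le_trans (ler_norm_sum _ _ _)).
  under eq_bigr do rewrite normrM !normsign mulr1.
  by rewrite sum_const_bits mulr1.
have sqE : \sum_x `|\sum_y graph_sign adj (glue S x y) * b y| ^+ 2 =
           \sum_y \sum_y' b y * cconj (b y') * G y y'.
  under eq_bigr => x _ do rewrite normCK rmorph_sum big_distrlr /=.
  rewrite exchange_big /=; apply: eq_bigr => y _; rewrite exchange_big /=.
  apply: eq_bigr => y' _; rewrite mulr_sumr; apply: eq_bigr => x _.
  by rewrite rmorphM /= -!/(cconj _) cconj_graph_sign; ring.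
have amgm (u v : C) : `|u| * `|v| <= 2^-1 * (`|u| ^+ 2 + `|v| ^+ 2).
  rewrite -subr_ge0.
  have -> : 2^-1 * (`|u| ^+ 2 + `|v| ^+ 2) - `|u| * `|v| = 2^-1 * (`|u| - `|v|) ^+ 2.
    by field.
  by rewrite mulr_ge0 ?invr_ge0 ?ler0n // real_exprn_even_ge0 // rpredB ?normr_real.
(* Schur test: |b_y| |b_y'| is replaced by the mean of the squares, and symmetry of [E] merges the
   two halves. *)
have le1 : \sum_x `|\sum_y graph_sign adj (glue S x y) * b y| ^+ 2 <=
    2 ^+ n * \sum_y \sum_y' (E y y')%:R * `|b y| ^+ 2.
  apply: (@le_trans _ _ (\sum_y \sum_y'
      2^-1 * (`|b y| ^+ 2 + `|b y'| ^+ 2) * ((E y y')%:R * 2 ^+ n))).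
    rewrite -[leLHS]ger0_norm; last by apply: sumr_ge0 => x _; rewrite exprn_ge0.
    rewrite sqE; apply: (le_trans (ler_norm_sum _ _ _)); apply: ler_sum => y _.
    apply: (le_trans (ler_norm_sum _ _ _)); apply: ler_sum => y' _.
    rewrite !normrM norm_conjC; apply: ler_pM => //; first by rewrite mulr_ge0.
  rewrite le_eqVlt; apply/orP; left; apply/eqP.
  transitivity (2^-1 * (2 ^+ n * (\sum_y \sum_y' (E y y')%:R * `|b y| ^+ 2)
    + 2 ^+ n * \sum_y \sum_y' (E y y')%:R * `|b y'| ^+ 2)).
    rewrite !mulr_sumr -big_split mulr_sumr; apply: eq_bigr => y _ /=.
    rewrite !mulr_sumr -big_split mulr_sumr; apply: eq_bigr => y' _ /=.
    ring.
  have -> : \sum_y \sum_y' (E y y')%:R * `|b y'| ^+ 2 =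
            \sum_y \sum_y' (E y y')%:R * `|b y| ^+ 2.
    rewrite exchange_big /=; apply: eq_bigr => y _; apply: eq_bigr => y' _.
    by rewrite Esym.
  by field.
apply: (le_trans (ler_wpM2r (exprn_ge0 _ (ler0n _ 2)) le1)).
rewrite -!mulrA ler_pM2l ?exprn_gt0 ?ltr0n // mulr_suml mulr_sumr; apply: ler_sum => y _.
rewrite -mulr_suml mulrAC; apply: ler_wpM2r; first by rewrite exprn_ge0.
rewrite -natr_sum -!natrX -natrM ler_nat.
apply: leq_trans (card_out_sign_class y tS adjst).
rewrite leq_mul2r -sum1dep_card [in leqRHS]big_mkcond /=; apply/orP; right.
by apply: leq_sum => y' _; rewrite /E; case: [forall l in L, _].
Qed.

(* The edges (s l, t l) form an induced matching of the bipartite graph between S and its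
   complement, i.e. the cut matrix of S contains an identity block of size #|L|. *)
Lemma graph_state_overlap_le (adj : rel nat) (n : nat) (S : {set 'I_n})
    (J : finType) (L : {set J}) (s t : J -> 'I_n) :
    symmetric adj ->
    (forall l, l \in L -> s l \in S) -> (forall l, l \in L -> t l \notin S) ->
    (forall l l', l \in L -> l' \in L -> adj (s l) (t l') = (l == l')) ->
  overlap_le (cut_product S) (graph_state adj n) (2^-1 ^+ #|L|).
Proof.
move=> sym_adj sS tS adjst w wS; rewrite graph_state_is_state mulr1.
have [a [b wE]] := cut_product_factor wS.
pose F : C := \sum_x graph_sign adj x * w x.
have innerE : inner (graph_state adj n) w = had_coef ^+ n * F.
  rewrite /inner mulr_sumr; apply: eq_bigr => x _.
  rewrite graph_stateE cconjM cconj_graph_sign mulrA; congr (_ * _ * _).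
  by rewrite /cconj rmorphXn /= -/(cconj _) cconj_had_coef.
(* When [x] and [y] both range over all strings, every glued string arises 2^n times, whence the
   factor. *)
have F2 : 2 ^+ n * F = \sum_x a x * \sum_y graph_sign adj (glue S x y) * b y.
  rewrite /F [LHS]mulr_sumr.
  rewrite (eq_bigr _ (fun x _ => esym (sum_const_bits n (graph_sign adj x * w x)))).
  rewrite (sum_glue_swap S); apply: eq_bigr => x _; rewrite mulr_sumr.
  by apply: eq_bigr => y _; rewrite wE; ring.
have ww : 2 ^+ n * inner w w = (\sum_x `|a x| ^+ 2) * \sum_y `|b y| ^+ 2.
  rewrite norm2_innerxx [LHS]mulr_sumr.
  rewrite (eq_bigr _ (fun x _ => esym (sum_const_bits n (`|w x| ^+ 2)))).
  rewrite (sum_glue_swap S) big_distrlr /=; apply: eq_bigr => x _; apply: eq_bigr => y _.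
  by rewrite wE normrM exprMn.
(* Cauchy-Schwarz in [x] separates [a] from the sign matrix, whose action on [b] is bounded by
   [signed_sum_bound]. *)
have cs : `|2 ^+ n * F| ^+ 2 * 2 ^+ #|L| <= 2 ^+ n * 2 ^+ n * (2 ^+ n * inner w w).
  rewrite F2 ww; apply: (@le_trans _ _ ((\sum_x `|a x| ^+ 2) *
    (\sum_x `|\sum_y graph_sign adj (glue S x y) * b y| ^+ 2) * 2 ^+ #|L|)).
    apply: ler_wpM2r; first by rewrite exprn_ge0 ?ler0n.
    apply: cauchy_sum => x _; rewrite ?exprn_ge0 //.
    by rewrite normrM exprMn.
  rewrite -mulrA [leRHS]mulrCA; apply: ler_wpM2l.
    by apply: sumr_ge0 => x _; rewrite exprn_ge0.
  exact: (signed_sum_bound b sym_adj sS tS adjst).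
have p2 : 0 < (2 : C) ^+ n by rewrite exprn_gt0 ?ltr0n.
rewrite innerE normrM exprMn ger0_norm ?exprn_ge0 ?had_coef_ge0 //.
rewrite -exprM mulnC exprM had_coef2 exprVn exprVn.
rewrite mulrC ler_pdivrMr // -mulrA [leRHS]mulrC ler_pdivlMr ?exprn_gt0 ?ltr0n //.
rewrite -(ler_pM2l (mulr_gt0 p2 p2)).
move: cs; rewrite normrM exprMn (ger0_norm (ltW p2)).
set q := 2 ^+ n; set f := `|F| ^+ 2; set g := 2 ^+ #|L|; set v := inner w w.
have -> : q ^+ 2 * f * g = q * q * (f * g) by ring.
by rewrite [v * q]mulrC.
Qed.

(** * Induced matchings across cuts of the grid *)

(* The k x k grid with vertices numbered row by row; for simplicity the end of each row
   is also joined to the start of the next one. *)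
Definition grid_adj (k : nat) : rel nat := fun i j =>
  [|| j == i + 1, i == j + 1, j == i + k | i == j + k]%N.

Lemma grid_adj_sym (k : nat) : symmetric (grid_adj k).
Proof. by move=> i j; rewrite /grid_adj; do 4!case: eqP => //=. Qed.

Lemma bool_change (q : nat -> bool) (k i j : nat) :
  (i < k)%N -> (j < k)%N -> q i != q j ->
  exists c, (c.+1 < k)%N /\ q c != q c.+1.
Proof.
move=> ik jk; apply: contraPP => h.
have q0 l : (l < k)%N -> q l = q 0%N.
  elim: l => // l IH lk; rewrite -IH; last exact: ltnW.
  by apply/eqP/negPn/negP => ql; apply: h; exists l; rewrite eq_sym.
by rewrite (q0 i) // (q0 j) // eqxx.
Qed.

(** Keeping the rows or columns of one parity costs a factor of two and makes distinct remaining
    lines non-adjacent. *)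
Lemma parity_pigeonhole (k : nat) (X : {set 'I_k}) :
  exists e, (#|X| <= 2 * #|[set l in X | odd l == e]|)%N.
Proof.
have -> : #|X| = (#|[set l in X | odd l == true]| + #|[set l in X | odd l == false]|)%N.
  rewrite -(cardsID [set l : 'I_k | odd l]); congr (_ + _)%N;
  by apply: eq_card => l; rewrite !inE; case: (odd l); rewrite ?andbF ?andbT.
case: (leqP #|[set l in X | odd l == true]| #|[set l in X | odd l == false]|) => h.
  by exists false; lia.
by exists true; lia.
Qed.

(** Distinct rows of equal parity differ by at least two, so the vertex numbers differ by more than
    [k]. *)
Lemma row_edges_apart (k l l' c c' a b : nat) :
  (c < k)%N -> (c' < k)%N -> odd l = odd l' -> l <> l' ->
  a = (l * k + c)%N -> b = (l' * k + c')%N -> grid_adj k a b = false.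
Proof.
move=> ck c'k oll ll' -> ->; rewrite /grid_adj.
have [lt|lt] : (l.+2 <= l' \/ l'.+2 <= l)%N by lia.
- by have := leq_mul lt (leqnn k); rewrite !mulSn => h;
     apply/negbTE; rewrite !negb_or; apply/and4P; split; apply/eqP; lia.
- by have := leq_mul lt (leqnn k); rewrite !mulSn => h;
     apply/negbTE; rewrite !negb_or; apply/and4P; split; apply/eqP; lia.
Qed.

(** For even [k] the parity of a vertex number is that of its column, so numbers in columns of equal
    parity never differ by 1, even where a row is joined to the next. A difference of [k] would
    force equal columns. *)
Lemma column_edges_apart (k l l' r r' a b : nat) :
  ~~ odd k -> (l < k)%N -> (l' < k)%N -> odd l = odd l' -> l <> l' ->
  a = (r * k + l)%N -> b = (r' * k + l')%N -> grid_adj k a b = false.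
Proof.
move=> ok lk l'k oll ll' -> ->; rewrite /grid_adj.
have par (x y : nat) : odd x = odd y -> (x == y + 1)%N = false.
  by move=> oxy; apply/eqP => e; move: oxy; rewrite e addn1 /=; case: (odd y).
have odd_ab : odd (r * k + l) = odd (r' * k + l').
  by rewrite !oddD !oddM (negbTE ok) !andbF.
rewrite !par //=; apply/norP; split; apply/eqP.
- rewrite addnAC -mulSnr => /(congr1 (modn^~ k)); rewrite !modnMDl !modn_small //.
  by move=> e; apply: ll'.
- rewrite addnAC -mulSnr => /(congr1 (modn^~ k)); rewrite !modnMDl !modn_small //.
Qed.

(** Either every row meets both sides of the cut, or some row [r0] lies on one side. In the second
    case every column with a vertex on the other side meets both, and there are at least k / 4 such
    columns. A line meeting both sides contains a crossing edge; restricting to one parity leaves k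
    / 8 of them. *)
Lemma grid_induced_matching (n k : nat) (S : {set 'I_n}) :
  n = (k * k)%N -> (0 < k)%N -> ~~ odd k ->
  (n <= 4 * #|S|)%N -> (n <= 4 * #|~: S|)%N ->
  exists (L : {set 'I_k}) (s t : 'I_k -> 'I_n),
    [/\ (k <= 8 * #|L|)%N, (forall l, l \in L -> s l \in S),
        (forall l, l \in L -> t l \notin S) &
        (forall l l', l \in L -> l' \in L -> grid_adj k (s l) (t l') = (l == l'))].
Proof.
move=> nk k0 ok S4 SC4.
have n0 : (0 < n)%N by rewrite nk muln_gt0 k0.
have cellP r c : (r < k)%N -> (c < k)%N -> (r * k + c < n)%N.
  move=> rk ck; rewrite nk; apply: (@leq_trans (r.+1 * k)); last by rewrite leq_mul2r rk orbT.
  by rewrite mulSn addnC ltn_add2r.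
(* Membership in [S] as a predicate on numbers, false out of range, so that positions can be
   computed arithmetically. *)
pose p i := if insub i is Some j then (j : 'I_n) \in S else false.
have pE (j : 'I_n) : p j = (j \in S) by rewrite /p valK.
have pick_edge i j : (i < n)%N -> (j < n)%N -> p i != p j -> grid_adj k i j ->
    exists ab : 'I_n * 'I_n, [/\ ab.1 \in S, ab.2 \notin S, grid_adj k ab.1 ab.2 &
      (val ab.1 = i /\ val ab.2 = j) \/ (val ab.1 = j /\ val ab.2 = i)].
  move=> ilt jlt; rewrite -[ i ]/(val (Ordinal ilt)) -[j]/(val (Ordinal jlt)) !pE.
  case iS: (_ \in S); case jS: (_ \in S) => // _ ij.
  - by exists (Ordinal ilt, Ordinal jlt); rewrite /= iS jS; split=> //; left.
  - exists (Ordinal jlt, Ordinal ilt); rewrite /= iS jS grid_adj_sym; split=> //.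
    by right.
(* The common end of both cases: [line l] describes the row or the column with index [l]. *)
have conclude (X : {set 'I_k}) (line : 'I_k -> 'I_n -> Prop) :
    (k <= 4 * #|X|)%N ->
    (forall l, l \in X -> exists ab : 'I_n * 'I_n, [/\ ab.1 \in S, ab.2 \notin S,
       grid_adj k ab.1 ab.2 & line l ab.1 /\ line l ab.2]) ->
    (forall l l' a b, line l a -> line l' b -> odd l = odd l' -> l <> l' ->
       grid_adj k a b = false) ->
    exists (L : {set 'I_k}) (s t : 'I_k -> 'I_n),
    [/\ (k <= 8 * #|L|)%N, (forall l, l \in L -> s l \in S),
        (forall l, l \in L -> t l \notin S) &
        (forall l l', l \in L -> l' \in L -> grid_adj k (s l) (t l') = (l == l'))].
  move=> Xk Xline lineP; have [e Xe] := parity_pigeonhole X.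
  have gex (l : 'I_k) : exists ab : 'I_n * 'I_n, l \in X -> [/\ ab.1 \in S, ab.2 \notin S,
        grid_adj k ab.1 ab.2 & line l ab.1 /\ line l ab.2].
    case lX: (l \in X); last by exists (Ordinal n0, Ordinal n0).
    by have [ab abP] := Xline l lX; exists ab.
  have [g gP] := choice gex.
  exists [set l in X | odd l == e], (fun l => (g l).1), (fun l => (g l).2); split.
  - by lia.
  - by move=> l; rewrite inE => /andP[/gP[]].
  - by move=> l; rewrite inE => /andP[/gP[]].
  - move=> l l'; rewrite !inE => /andP[/gP[_ _ adjl [ln _]] /eqP ol].
    move=> /andP[/gP[_ _ _ [_ ln']] /eqP ol'].
    have [<- //|/eqP ll'] := eqVneq l l'.
    by apply: lineP ll' => //; rewrite ol ol'.
have [/forallP rows|] := boolP [forall r : 'I_k, [exists c : 'I_k, [exists c' : 'I_k,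
    p (r * k + c)%N != p (r * k + c')%N]]].
  apply: (conclude (finset.setTfor _) (fun r a => exists2 c, (c < k)%N & val a = (r * k + c)%N)).
  - by rewrite cardsT card_ord; lia.
  - move=> r _; have /existsP[c /existsP[c' cc']] := rows r.
    have [d [dk pd]] := bool_change (q := fun c => p (r * k + c)%N)
      (ltn_ord c) (ltn_ord c') cc'.
    have adjd : grid_adj k (r * k + d)%N (r * k + d.+1)%N.
      by rewrite /grid_adj addnS addn1 eqxx.
    have [ab [aS bS abadj abE]] := pick_edge _ _ (cellP r d (ltn_ord r) (ltnW dk))
      (cellP r d.+1 (ltn_ord r) dk) pd adjd.
    exists ab; split=> //.
    by case: abE => -[-> ->]; split; [exists d|exists d.+1|exists d.+1|exists d];
       rewrite // ltnW.
  - move=> l l' a b [c ck aE] [c' c'k bE] oll ll'.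
    by apply: row_edges_apart aE bE => // /val_inj.
rewrite negb_forall => /existsP[r0]; rewrite negb_exists => /forallP mono.
pose e0 := p (r0 * k)%N.
have row0 (c : 'I_k) : p (r0 * k + c)%N = e0.
  have := mono c; rewrite negb_exists => /forallP/(_ (Ordinal k0)).
  by rewrite negbK /= addn0 => /eqP.
pose X := [set c : 'I_k | [exists r : 'I_k, p (r * k + c)%N != e0]].
apply: (conclude X (fun c a => exists r, val a = (r * k + c)%N)).
(* Column and row coordinates embed the vertices on the side not containing row [r0] into [X] times
   the rows. They number at least n / 4 = k^2 / 4. *)
- have cardX : (#|[set j : 'I_n | (j \in S) != e0]| <= #|X| * k)%N.
    pose col (j : 'I_n) : 'I_k := Ordinal (ltn_pmod j k0).
    have row_lt (j : 'I_n) : (j %/ k < k)%N by rewrite ltn_divLR // -nk.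
    pose row (j : 'I_n) : 'I_k := Ordinal (row_lt j).
    pose h (j : 'I_n) := (col j, row j).
    have hI : injective h.
      move=> j j' [ec er]; apply: val_inj.
      by rewrite /= (divn_eq j k) (divn_eq j' k) ec er.
    rewrite -(card_imset _ hI) -[X in (_ <= _ * X)%N](card_ord k) -cardsT -cardsX.
    apply/subset_leq_card/fintype.subsetP => _ /imsetP[j jS ->].
    rewrite !inE andbT; apply/existsP; exists (row j) => /=.
    by rewrite -divn_eq pE; move: jS; rewrite inE.
  have : (n <= 4 * #|[set j : 'I_n | (j \in S) != e0]|)%N.
    move: e0 {row0 X cardX} => [].
      have -> : [set j : 'I_n | (j \in S) != true] = ~: S.
        by apply/setP => j; rewrite !inE; case: (j \in S).
      by [].
    have -> : [set j : 'I_n | (j \in S) != false] = S.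
      by apply/setP => j; rewrite !inE; case: (j \in S).
    by [].
  move=> n4; rewrite -(leq_pmul2r k0) -nk -mulnA.
  by apply: (leq_trans n4); rewrite leq_mul2l cardX.
- move=> c; rewrite inE => /existsP[r pr].
  have pr0 : p (r * k + c)%N != p (r0 * k + c)%N by rewrite row0.
  have [d [dk pd]] := bool_change (q := fun r => p (r * k + c)%N)
    (ltn_ord r) (ltn_ord r0) pr0.
  have adjd : grid_adj k (d * k + c)%N (d.+1 * k + c)%N.
    by rewrite /grid_adj mulSn; apply/or4P/Or43; apply/eqP; lia.
  have [ab [aS bS abadj abE]] := pick_edge _ _ (cellP d c (ltnW dk) (ltn_ord c))
    (cellP d.+1 c dk (ltn_ord c)) pd adjd.
  exists ab; split=> //.
  by case: abE => -[-> ->]; split; [exists d|exists d.+1|exists d.+1|exists d].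
- move=> l l' a b [r aE] [r' bE] oll ll'.
  by apply: column_edges_apart aE bE => //; first move=> /val_inj.
Qed.

(** * Balanced edges of subcubic trees *)

Lemma crossing_edge (V : finType) (e : rel V) (X : {set V}) (a b : V) :
    symmetric e -> (forall u v, connect e u v) -> a \in X -> b \notin X ->
  exists x y, [/\ x \in X, y \notin X & e x y].
Proof.
move=> e_sym e_conn aX bX; apply: contrapT => h.
have Xcl : closed e (mem X).
  move=> x y xy; case xX: (x \in X); case yX: (y \in X) => //; case: h.
    by exists x, y; rewrite xX yX.
  by exists y, x; rewrite xX yX e_sym.
by move: bX; rewrite -(closed_connect Xcl (e_conn a b)) aX.
Qed.

(** A vertex set grown one vertex at a time along crossing edges gains two ordered pairs at each
    step. *)
Lemma connected_card_edges (V : finType) (e : rel V) :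
    symmetric e -> (forall u v, connect e u v) ->
  ((#|V|.-1).*2 <= #|[set p : V * V | e p.1 p.2]|)%N.
Proof.
move=> e_sym e_conn; pose E (X : {set V}) :=
  [set p : V * V | [&& e p.1 p.2, p.1 \in X & p.2 \in X]].
have grow m : (m < #|V|)%N -> exists2 X : {set V}, #|X| = m.+1 & (m.*2 <= #|E X|)%N.
  elim: m => [/card_gt0P[a _]|m IH mV]; first by exists [set a]; rewrite ?cards1.
  have [X cX EX] := IH (ltnW mV).
  have [a aX] : exists a, a \in X by apply/card_gt0P; rewrite cX.
  have [b bX] : exists b, b \notin X.
    have : (0 < #|~: X|)%N by rewrite cardsCs finset.setCK cX subn_gt0.
    by move=> /card_gt0P[b]; rewrite inE; exists b.
  have [x [y [xX yX xy]]] := crossing_edge e_sym e_conn aX bX.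
  exists (y |: X); first by rewrite cardsU1 yX cX.
  have dis : [disjoint E X & [set (x, y); (y, x)]].
    rewrite disjoint_subset; apply/fintype.subsetP => -[p q]; rewrite !inE /=.
    move=> /and3P[_ pX qX]; rewrite negb_or !xpair_eqE !negb_and.
    by apply/andP; split; apply/orP; [right|left];
       apply: contraNneq yX => <-.
  have sub : E X :|: [set (x, y); (y, x)] \subset E (y |: X).
    apply/fintype.subsetP => -[p q]; rewrite !inE !xpair_eqE /=.
    case/or3P => [/and3P[-> -> ->]|/andP[/eqP-> /eqP->]|/andP[/eqP-> /eqP->]].
    - by rewrite !orbT.
    - by rewrite xy xX eqxx !orbT.
    - by rewrite e_sym xy xX eqxx !orbT.
  apply: leq_trans (subset_leq_card sub).
  rewrite cardsU disjoint_setI0 // cards0 subn0 cards2 xpair_eqE.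
  have /negbTE-> : x != y by apply: contraNneq yX => <-.
  by rewrite doubleS /= addn2 !ltnS.
case: (posnP #|V|) => [-> //|V0].
have [|X _ EX] := grow #|V|.-1; first by rewrite ltn_predL.
apply: (leq_trans EX); apply/subset_leq_card/fintype.subsetP => p.
by rewrite !inE => /and3P[].
Qed.

Lemma cut_adj_sym (M : nat) (adj : rel 'I_M) u v :
  symmetric adj -> symmetric (cut_adj adj u v).
Proof. by move=> s x y; rewrite /cut_adj s orbC ![(y == _) && _]andbC. Qed.

Lemma cut_adjC (M : nat) (adj : rel 'I_M) u v : cut_adj adj u v =2 cut_adj adj v u.
Proof. by move=> x y; rewrite /cut_adj orbC. Qed.

(** If the ends stayed connected, the cut graph would be connected with fewer edges than
    [connected_card_edges] demands. *)
Lemma tree_edge_bridge (N : nat) (T : subcubic_tree N) (u v : 'I_(st_size T)) :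
  st_adj u v -> ~~ connect (cut_adj (@st_adj N T) u v) u v.
Proof.
move=> uv; apply/negP => cuv; set c := cut_adj _ u v in cuv.
have c_sym : symmetric c by apply: cut_adj_sym; exact: st_sym.
have c_conn x y : connect c x y.
  apply: connect_sub (st_conn x y) => a b ab.
  case cab: (c a b); first exact: connect1.
  move: cab; rewrite /c /cut_adj ab /= => /negbFE/orP[]/andP[/eqP-> /eqP->] //.
  by rewrite (sym_connect_sym c_sym).
have := connected_card_edges c_sym c_conn; rewrite card_ord -st_edges.
apply/negP; rewrite -ltnNge; apply: proper_card; apply/properP; split.
  by apply/fintype.subsetP => p; rewrite !inE => /andP[].
by exists (u, v); rewrite !inE //= /c /cut_adj !eqxx andbF.
Qed.

(** Otherwise an edge leaves the set reached from [u] or [v]. It is not the removed edge, both ends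
    of which are reached, so it would extend the reach. *)
Lemma tree_cut_cover (N : nat) (T : subcubic_tree N) (u v z : 'I_(st_size T)) :
  connect (cut_adj (@st_adj N T) u v) u z || connect (cut_adj (@st_adj N T) u v) v z.
Proof.
set c := cut_adj _ u v; have c_sym : symmetric c by apply: cut_adj_sym; exact: st_sym.
pose X := [set z | connect c u z || connect c v z].
suff : z \in X by rewrite inE.
apply: contrapT => /negP zX.
have uX : u \in X by rewrite inE connect0.
have [x [y [xX yX xy]]] := crossing_edge (@st_sym N T) (@st_conn N T) uX zX.
case/negP: yX; case cxy: (c x y).
  move: xX; rewrite !inE => /orP[]h; apply/orP; [left|right];
  exact: connect_trans h (connect1 cxy).
move: cxy; rewrite /c /cut_adj xy /= => /negbFE/orP[]/andP[_ /eqP->]; rewrite inE.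
  by rewrite connect0 orbT.
by rewrite connect0.
Qed.

(** A simple path from [u] to [z] first moves to some [w] and never returns to [u], so its remainder
    survives the removal of the edge at [w] and [u]. *)
Lemma tree_side_split (N : nat) (T : subcubic_tree N) (u v z : 'I_(st_size T)) :
  connect (cut_adj (@st_adj N T) u v) u z -> z != u ->
  exists w, [/\ st_adj u w, w != v & connect (cut_adj (@st_adj N T) w u) w z].
Proof.
move=> /connectP[p0 p0p ->]; case/shortenP: p0p => -[|w p] /=; first by rewrite eqxx.
move=> /andP[/andP[uw cutn] pp] /andP[up _] _ _; exists w; split=> //.
  by apply: contraNneq cutn => ->; rewrite !eqxx.
apply/connectP; exists p => //.
apply: (@sub_in_path _ (fun x => x != u) (cut_adj (@st_adj N T) u v)) pp.
  move=> x y; rewrite !unfold_in /= => xu yu /andP[xy _]; rewrite /cut_adj xy /=.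
  by rewrite (negbTE xu) (negbTE yu) !andbF.
by apply/allP => x xp; apply: contraNneq up => <-.
Qed.

(** As the edge between [w] and [u] is a bridge, a path on the side of [w] avoids [u], hence also
    the edge between [u] and [v]. *)
Lemma tree_side_sub (N : nat) (T : subcubic_tree N) (u v w z : 'I_(st_size T)) :
  st_adj u w -> w != v -> connect (cut_adj (@st_adj N T) w u) w z ->
  connect (cut_adj (@st_adj N T) u v) u z.
Proof.
move=> uw wv /connectP[p pp ->].
have uNp x : x \in w :: p -> x != u.
  move=> xp; apply: contraNneq (tree_edge_bridge (etrans (st_sym w u) uw)) => xu.
  by have := path_connect pp xp; rewrite xu.
have wu : w != u by apply: uNp; rewrite inE eqxx.
apply: (@connect_trans _ _ w).
  by apply: connect1; rewrite /cut_adj uw (negbTE wv) (negbTE wu) !andbF.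
apply/connectP; exists p => //.
apply: (@sub_in_path _ (fun x => x != u) (cut_adj (@st_adj N T) w u)) pp.
  move=> x y; rewrite !unfold_in /= => xu yu /andP[xy _]; rewrite /cut_adj xy /=.
  by rewrite (negbTE xu) (negbTE yu) !andbF.
by apply/allP.
Qed.

Lemma card_bigcup_le (I V : finType) (P : {pred I}) (F : I -> {set V}) :
  (#|\bigcup_(i in P) F i| <= \sum_(i in P) #|F i|)%N.
Proof.
elim/big_rec2: _ => [|i a B _ le]; first by rewrite cards0.
by apply: (leq_trans (leq_card_setU _ _)); rewrite leq_add2l.
Qed.

(** Among the oriented edges with at least n / 4 targets on their side, take one whose side has the
    fewest vertices. The at most two further edges at [u] lead to smaller sides with fewer than n /
    4 targets each, and [u] itself carries at most one target, so enough targets remain on the other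
    side. *)
Lemma tree_balanced_edge (N n : nat) (T : subcubic_tree N) (f : 'I_n -> 'I_N) :
    injective f -> (2 <= n)%N ->
  exists p : 'I_(st_size T) * 'I_(st_size T),
    [/\ (p.1 < p.2)%N && st_adj p.1 p.2,
        (n <= 4 * #|f @^-1: cut_side p.1 p.2|)%N &
        (n <= 4 * #|~: (f @^-1: cut_side p.1 p.2)|)%N].
Proof.
move=> fI n2; pose adj := @st_adj N T; pose side u v := connect (cut_adj adj u v) u.
pose W u v := #|f @^-1: @cut_side N T u v|.
have inW u v i : (i \in f @^-1: @cut_side N T u v) = side u v (st_leaf T (f i)).
  by rewrite !inE.
have sideC u v z : side v u z = connect (cut_adj adj u v) v z.
  by apply: eq_connect => x y; rewrite cut_adjC.
have cover u v : (n <= W u v + W v u)%N.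
  rewrite -[X in (X <= _)%N](card_ord n) -cardsT.
  apply: (leq_trans _ (leq_card_setU _ _)); apply/subset_leq_card/fintype.subsetP => i _.
  by rewrite finset.in_setU !inW (sideC u v); exact: tree_cut_cover.
(* [tree_width] lists each edge with its smaller end first, so the chosen orientation may have to be
   reversed; the two sides partition the targets. *)
have balanced u v : adj u v -> (n <= 4 * W u v)%N -> (n <= 4 * (n - W u v))%N ->
  exists p : 'I_(st_size T) * 'I_(st_size T),
    [/\ (p.1 < p.2)%N && st_adj p.1 p.2,
        (n <= 4 * #|f @^-1: cut_side p.1 p.2|)%N &
        (n <= 4 * #|~: (f @^-1: cut_side p.1 p.2)|)%N].
  move=> uv Wuv CWuv.
  have CE a b : #|~: (f @^-1: @cut_side N T a b)| = (n - W a b)%N.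
    by rewrite cardsCs finset.setCK card_ord.
  have [uvl|vul] := ltnP u v; first by exists (u, v); rewrite /= uvl CE.
  have vu : (v < u)%N.
    by rewrite ltn_neqAle vul andbT; apply/eqP => /val_inj e; move: uv; rewrite e /adj st_irr.
  exists (v, u); rewrite /= vu CE st_sym; split=> //.
    by have := cover u v; rewrite -/(W v u); lia.
  suff : (W u v + W v u <= n)%N by lia.
  rewrite -[X in (_ <= X)%N](card_ord n) -cardsUI [X in (_ + X)%N](_ : _ = 0%N) ?addn0 ?max_card //.
  apply/eqP; rewrite cards_eq0; apply/eqP/setP => i.
  rewrite finset.in_setI !inW (sideC u v) finset.in_set0.
  apply/negP => /andP[uz vz]; case/negP: (tree_edge_bridge uv).
  apply: connect_trans uz _; rewrite sym_connect_sym //.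
  by apply: cut_adj_sym; exact: st_sym.
have i0 : 'I_n by apply: (@Ordinal _ 0); exact: ltnW.
have [u0 [v0 [uv0 Wuv0]]] : exists u v, adj u v /\ (n <= 4 * W u v)%N.
  pose u := st_leaf T (f i0).
  have [v uv] : exists v, adj u v.
    have /card_gt0P[v] : (0 < #|[set w | st_adj u w]|)%N.
      by have := st_deg u; rewrite !inE => /orP[]/eqP->.
    by rewrite inE; exists v.
  have [h|h] : (n <= 4 * W u v)%N \/ (n <= 4 * W v u)%N by have := cover u v; lia.
    by exists u, v.
  by exists v, u; rewrite /adj st_sym.
pose good (p : 'I_(st_size T) * 'I_(st_size T)) := adj p.1 p.2 && (n <= 4 * W p.1 p.2)%N.
have good0 : good (u0, v0) by rewrite /good /= uv0.
case: (arg_minnP (fun p => #|[set z | side p.1 p.2 z]|) good0) => -[u v] /andP[/= uv Wuv] min.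
apply: (balanced u v) => //.
pose Nb := [set w | adj u w] :\ v.
have Nb2 : (#|Nb| <= 2)%N.
  have := cardsD1 v [set w | adj u w]; rewrite inE uv -/Nb.
  by have := st_deg u; rewrite !inE => /orP[]/eqP; rewrite /adj => ->; lia.
have Wsmall w : w \in Nb -> (4 * W w u <= n.-1)%N.
  rewrite !inE => /andP[wv uw]; rewrite -ltnS prednK ?(ltnW n2) // ltnNge.
  apply/negP => Wn.
  have /min : good (w, u) by rewrite /good /= Wn andbT /adj st_sym.
  (* The side of [w] lies inside the side of [u] and misses [u], which contradicts minimality. *)
  apply/negP; rewrite -ltnNge; apply: proper_card; apply/properP; split.
    by apply/fintype.subsetP => z; rewrite !inE /=; exact: tree_side_sub.
  exists u; rewrite inE /=; first exact: connect0.
  by apply: tree_edge_bridge; rewrite st_sym.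
have leW : (W u v <= 1 + \sum_(w in Nb) W w u)%N.
  pose U := [set i | st_leaf T (f i) == u] :|:
            \bigcup_(w in Nb) (f @^-1: @cut_side N T w u).
  have WU : f @^-1: @cut_side N T u v \subset U.
    apply/fintype.subsetP => i; rewrite inW => iu; rewrite finset.in_setU inE.
    have [//|iNu] := eqVneq (st_leaf T (f i)) u.
    have [w [uw wv wi]] := tree_side_split iu iNu.
    by apply/bigcupP; exists w; rewrite ?inW // !inE wv.
  apply: (leq_trans (subset_leq_card WU)); apply: (leq_trans (leq_card_setU _ _)).
  apply: leq_add; last exact: card_bigcup_le.
  apply/card_le1_eqP => i j; rewrite !inE => /eqP iu /eqP ju.
  by apply/fI/(@st_leaf_inj N T); rewrite iu ju.
have : (\sum_(w in Nb) 4 * W w u <= \sum_(w in Nb) n.-1)%N by apply: leq_sum.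
rewrite -big_distrr sum_nat_const /= => le4.
have : (#|Nb| * n.-1 <= 2 * n.-1)%N by rewrite leq_mul2r Nb2 orbT.
(* The bounds give 4 W <= 4 + 2 (n - 1), so the complement is large enough once n >= 2. *)
by move: leW le4; move: (\sum_(w in Nb) _)%N (#|Nb| * _)%N => a b; lia.
Qed.

(** * Existence of subcubic trees *)

(* Vertex 0 hangs on the root 1 of a binary heap, so that i and i./2 are adjacent for
   every 0 < i. *)
Definition heap_adj (M : nat) : rel 'I_M := fun i j =>
  ((0 < i)%N && (j == i./2 :> nat)) || ((0 < j)%N && (i == j./2 :> nat)).

Lemma heap_adj_sym (M : nat) : symmetric (@heap_adj M).
Proof. by move=> i j; rewrite /heap_adj orbC. Qed.

Lemma heap_adj_irr (M : nat) : irreflexive (@heap_adj M).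
Proof. by move=> i; rewrite /heap_adj orbb; apply/negP => /andP[i0 /eqP]; lia. Qed.

Lemma heap_adj_conn (M : nat) (u v : 'I_M) : connect (@heap_adj M) u v.
Proof.
have M0 : (0 < M)%N by case: M u {v} => [[]|].
suff root w : connect (@heap_adj M) w (Ordinal M0).
  apply: connect_trans (root u) _; rewrite sym_connect_sym //; exact: heap_adj_sym.
have [k] := ubnP (nat_of_ord w); elim: k w => // k IH w wk.
have [w0|w0] := posnP w; first by rewrite (_ : w = Ordinal M0) ?connect0 //; apply: val_inj.
have hM : (w./2 < M)%N by have := ltn_ord w; rewrite /= in w0 *; lia.
apply: connect_trans (IH (Ordinal hM) _); last by rewrite /= in w0 wk *; lia.
by apply: connect1; rewrite /heap_adj w0 eqxx.
Qed.

(** Each vertex other than 0 contributes the edge to its half, and the two orientations form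
    disjoint sets. *)
Lemma heap_adj_edges (M : nat) :
  #|[set p : 'I_M * 'I_M | heap_adj p.1 p.2]| = (M.-1).*2.
Proof.
case: M => [|M]; first by apply: eq_card0 => -[[]].
have hM (i : 'I_M.+1) : (i./2 < M.+1)%N by have := ltn_ord i; rewrite /=; lia.
pose h i := Ordinal (hM i); pose P := [set~ (ord0 : 'I_M.+1)].
have -> : [set p : 'I_M.+1 * 'I_M.+1 | heap_adj p.1 p.2] =
          [set (i, h i) | i in P] :|: [set (h i, i) | i in P].
  apply/setP => -[i j]; rewrite !inE /heap_adj /=; apply/orP/orP => -[].
  - move=> /andP[i0 /eqP ji]; left; apply/imsetP; exists i.
      by rewrite !inE -(inj_eq val_inj) /= -lt0n.
    by congr (_, _); apply: val_inj.
  - move=> /andP[j0 /eqP ij]; right; apply/imsetP; exists j.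
      by rewrite !inE -(inj_eq val_inj) /= -lt0n.
    by congr (_, _); apply: val_inj.
  - move=> /imsetP[k]; rewrite !inE -(inj_eq val_inj) /= -lt0n => k0 [-> ->].
    by left; rewrite k0 eqxx.
  - move=> /imsetP[k]; rewrite !inE -(inj_eq val_inj) /= -lt0n => k0 [-> ->].
    by right; rewrite k0 eqxx.
rewrite cardsU [X in (_ - X)%N](_ : _ = 0%N); last first.
  apply/eqP; rewrite cards_eq0; apply/eqP/setP => -[i j]; rewrite !inE.
  apply/negP => /andP[/imsetP[k]]; rewrite !inE -(inj_eq val_inj) /= => k0 [-> ->].
  move=> /imsetP[l]; rewrite !inE -(inj_eq val_inj) /= => l0 [].
  by move=> /(congr1 val) /= e1 /(congr1 val) /= e2; lia.
by rewrite !card_imset ?cardsC1 ?card_ord ?subn0 ?addnn // => i j [].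
Qed.

Lemma heap_adj_deg (m : nat) (v : 'I_m.*2) :
  #|[set w | heap_adj v w]| = if (0 < v < m)%N then 3%N else 1%N.
Proof.
have [M0 M1] : (0 < m.*2 /\ 1 < m.*2)%N by have := ltn_ord v; lia.
have hM : (v./2 < m.*2)%N by have := ltn_ord v; rewrite /=; lia.
have [v0|v0] := posnP v.
  rewrite /= -(cards1 (Ordinal M1)); apply: eq_card => w.
  rewrite !inE /heap_adj -(inj_eq val_inj) v0 /=; apply/andP/eqP => [[w0 /eqP]|->//]; lia.
rewrite /=; case: ltnP => vm.
  have dM : (v.*2 < m.*2)%N by lia.
  have dM1 : (v.*2.+1 < m.*2)%N by lia.
  have -> : [set w | heap_adj v w] = Ordinal hM |: [set Ordinal dM; Ordinal dM1].
    apply/setP => w; rewrite !inE /heap_adj -!(inj_eq val_inj) v0 /=.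
    apply/orP/or3P => [[/eqP ->|/andP[w0 /eqP e]]|].
    - by constructor 1.
    - by have [ow|ow] := boolP (odd w); [constructor 3|constructor 2]; apply/eqP; lia.
    - by case=> /eqP ->; [left|right|right]; rewrite ?eqxx //; apply/andP; split;
         try apply/eqP; lia.
  rewrite cardsU1 cards2 !inE -!(inj_eq val_inj) /=.
  have -> : (v./2 == v.*2) = false by apply/eqP; lia.
  have -> : (v./2 == v.*2.+1) = false by apply/eqP; lia.
  by have -> : (v.*2 == v.*2.+1) = false by apply/eqP; lia.
rewrite -(cards1 (Ordinal hM)); apply: eq_card => w.
rewrite !inE /heap_adj -(inj_eq val_inj) v0 /=.
have -> : (0 < w)%N && (v == w./2 :> nat) = false; last by rewrite orbF.
by apply/negP => /andP[_ /eqP]; have := ltn_ord w; lia.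
Qed.

(** Ensures that the infima defining the tree measures range over non-empty sets. With m = N - 1,
    the heap on 2m vertices has as leaves the vertex 0 and the m vertices from m on, N in total. *)
Lemma subcubic_tree_exists (N : nat) : (2 <= N)%N -> inhabited (subcubic_tree N).
Proof.
move=> N2; pose m := N.-1.
have leaf_lt (i : 'I_N) : ((if nat_of_ord i == 0 then 0 else m + i.-1) < m.*2)%N.
  by have := ltn_ord i; rewrite /m; case: eqP => /= ?; lia.
constructor; apply: (@SubcubicTree N m.*2 (@heap_adj _) (fun i => Ordinal (leaf_lt i))).
- exact: heap_adj_sym.
- exact: heap_adj_irr.
- exact: heap_adj_conn.
- exact: heap_adj_edges.
- by move=> v; rewrite heap_adj_deg; case: ifP.
- move=> i j /(congr1 val) /= e; apply: val_inj; move: e.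
  by rewrite /m; case: eqP => ?; case: eqP => ? /=; lia.
- move=> v; rewrite heap_adj_deg; case: ifP => // vb _.
  have [v0|v0] := posnP v.
    have lt : (0 < N)%N by lia.
    by exists (Ordinal lt); apply: val_inj.
  have lt : (v - m + 1 < N)%N by have := ltn_ord v; rewrite /m; lia.
  exists (Ordinal lt); apply: val_inj => /=.
  by move: vb; rewrite v0 /= /m; case: eqP => /= ?; lia.
Qed.

Lemma tree_measure_ge (N n : nat) (f : 'I_n -> 'I_N) (g : {set 'I_N} -> R) (c : R) :
    injective f -> (2 <= n)%N ->
    (forall A : {set 'I_N}, (n <= 4 * #|f @^-1: A|)%N -> (n <= 4 * #|~: (f @^-1: A)|)%N ->
       c <= g A) ->
  c <= inf [set x | exists T : subcubic_tree N, x = tree_width T g]%classic.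
Proof.
move=> fI n2 hg.
have nN : (n <= N)%N by have := leq_card f fI; rewrite !card_ord.
have [T0] := subcubic_tree_exists (leq_trans n2 nN).
apply: lb_le_inf; first by exists (tree_width T0 g); exists T0.
move=> _ [T ->]; have [p [pP p1 p2]] := tree_balanced_edge T fI n2.
apply: (le_trans (hg _ p1 p2)); rewrite /tree_width.
exact: (le_bigmax_cond 0 (fun p : 'I_(st_size T) * 'I_(st_size T) =>
  g (@cut_side N T p.1 p.2)) pP).
Qed.

(** * GHZ states *)

Definition cnot_perm (a : bool * bool) : bool * bool := (a.1, a.1 (+) a.2).

Lemma cnot_permK : involutive cnot_perm.
Proof. by case=> [[] []]. Qed.

Definition cnot (a b : bool * bool) : C := (a == cnot_perm b)%:R.

Lemma unitary_cnot : unitary2 cnot.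
Proof.
move=> a b; rewrite (bigD1 (cnot_perm a)) //= big1 ?addr0.
  by rewrite /cnot eqxx /cconj rmorph1 mul1r (inj_eq (inv_inj cnot_permK)).
by move=> c /negbTE ca; rewrite /cnot ca /cconj rmorph0 mul0r.
Qed.

Definition ghz_circuit (n : nat) : seq (gate n) :=
  match n with
  | 0%N => [::]
  | n'.+1 => G1 ord0 hadamard :: [seq G2 ord0 k cnot | k <- enum [set~ (ord0 : 'I_n'.+1)]]
  end.

Definition ghz (n : nat) : vec n := run_circuit (ghz_circuit n).

Lemma ghz_preparable : poly_preparable ghz.
Proof.
exists ghz_circuit; split.
  exists 1%N => -[//|n]; rewrite /= size_map -cardE cardsC1 card_ord; lia.
move=> [//|n] _; split=> // g /= [<-|/List.in_map_iff[k [<- kin]]].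
  exact: unitary_hadamard.
split; last exact: unitary_cnot.
have : k \in enum [set~ (ord0 : 'I_n.+1)].
  by elim: (enum _) kin => //= a l IH [->|/IH]; rewrite inE ?eqxx // => ->; rewrite orbT.
by rewrite mem_enum !inE eq_sym.
Qed.

(** Invariant: the qubits in [l] already copy qubit 0, the remaining ones are still zero. *)
Lemma run_cnots (n : nat) (l : seq 'I_n.+1) : uniq l -> ord0 \notin l ->
  foldl (fun psi g => apply_gate g psi) (apply_gate (G1 ord0 hadamard) (zero_state n.+1))
    [seq G2 ord0 k cnot | k <- l]
  = [ffun x : bits n.+1 => had_coef *
      [forall k, (k != ord0) ==> (x k == (k \in l) && x ord0)]%:R].
Proof.
elim/last_ind: l => [_ _|l j IH].
  have := run_hadamards (n := n.+1) (l := [:: ord0]) isT => /= ->.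
  apply/ffunP => x; rewrite !ffunE expr1; congr (_ * _%:R); congr nat_of_bool.
  by apply: eq_forallb => k; rewrite !inE /= eqbF_neg.
rewrite rcons_uniq mem_rcons inE negb_or => /andP[jl lu] /andP[j0 l0].
rewrite map_rcons foldl_rcons IH //= {IH}; apply/ffunP => x; rewrite !ffunE.
rewrite (bigD1 (cnot_perm (x ord0, x j))) //= big1 ?addr0; last first.
  move=> bc bcx; rewrite /cnot (_ : _ == _ = false) ?mul0r //.
  by apply/eqP => e; case/eqP: bcx; rewrite e cnot_permK.
rewrite /cnot cnot_permK eqxx mul1r ffunE; congr (_ * _%:R); congr nat_of_bool.
apply: eq_forallb => k; rewrite !ffunE /= (negbTE j0).
rewrite mem_rcons inE; have [->|kj] := eqVneq k j.
  by rewrite (negbTE jl) /=; case: (x ord0); case: (x j).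
by have [->|] := eqVneq k ord0.
Qed.

Lemma ghzE (n : nat) (x : bits n.+1) :
  ghz n.+1 x = had_coef * [forall k, x k == x ord0]%:R.
Proof.
rewrite /ghz /run_circuit /= run_cnots ?enum_uniq ?mem_enum ?inE ?eqxx // ffunE.
congr (_ * _%:R); congr nat_of_bool; apply: eq_forallb => k.
rewrite mem_enum !inE; have [->|] := eqVneq k ord0; first by rewrite eqxx.
by [].
Qed.

(** * Sequential composition of protocols *)

Fixpoint locc_seq (N : nat) (P Q : locc N) : locc N :=
  match P with
  | LDone => Q
  | LRound m K nx => LRound K (fun j => locc_seq (nx j) Q)
  end.

Lemma locc_seq_valid (N : nat) (P Q : locc N) :
  locc_valid P -> locc_valid Q -> locc_valid (locc_seq P Q).
Proof.
move=> Pv Qv; elim: P Pv => //= m K nx IH [Kc nxv]; split=> // j.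
exact: IH.
Qed.

Lemma prod_applyZ (N : nat) ops (c : C) (psi : vec N) :
  prod_apply ops (c *: psi) = c *: prod_apply ops psi.
Proof.
apply/ffunP => x; rewrite !ffunE [RHS]mulr_sumr; apply: eq_bigr => y _.
by rewrite ffunE mulrCA.
Qed.

Lemma locc_achievesZ (N : nat) (Q : locc N) (c : C) (psi target : vec N) :
  locc_achieves Q psi target -> locc_achieves Q (c *: psi) target.
Proof.
elim: Q psi => [|m K nx IH] psi /=; first by case=> d ->; exists (c * d); rewrite scalerA.
by move=> h j; rewrite prod_applyZ; apply: IH.
Qed.

(** The first protocol reaches [mid] only up to a scalar; by linearity this scalar passes through
    the second. *)
Lemma locc_seq_achieves (N : nat) (P Q : locc N) (psi mid target : vec N) :
    locc_achieves P psi mid -> locc_achieves Q mid target ->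
  locc_achieves (locc_seq P Q) psi target.
Proof.
move=> + Qt; elim: P psi => [|m K nx IH] psi /=.
  by case=> c ->; apply: locc_achievesZ.
by move=> h j; apply: IH.
Qed.

Lemma prod_apply_diag (N : nat) (d : 'I_N -> bool -> C) (psi : vec N) (x : bits N) :
  prod_apply (fun k a b => (a == b)%:R * d k a) psi x = (\prod_k d k (x k)) * psi x.
Proof.
rewrite ffunE (bigD1 x) //= [X in _ + X]big1 ?addr0 => [|y yx].
  by congr (_ * _); apply: eq_bigr => k _; rewrite eqxx mul1r.
have /existsP[k yxk] : [exists k, y k != x k].
  rewrite -negb_forall; apply: contra yx => /forallP h.
  by apply/eqP/ffunP => k; apply/eqP/h.
by rewrite (bigD1 k) //= eq_sym (negbTE yxk) !mul0r.
Qed.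

Lemma prod_apply_embed (n N : nat) (f : 'I_n -> 'I_N) ops (phi : vec n) (x : bits N) :
    injective f ->
  prod_apply ops (embed f phi) x
  = \sum_(y : bits n) (\prod_k ops k (x k) (extend f y k)) * phi y.
Proof.
move=> fI; rewrite ffunE.
under [RHS]eq_bigr => y _ do rewrite -{1}(embed_extend phi y fI).
rewrite -(sum_extend (fun y => (\prod_k ops k (x k) (y k)) * embed f phi y)) //.
rewrite [RHS]big_mkcond /=; apply: eq_bigr => y _; rewrite ffunE.
by case: ifP => //; rewrite mulr0.
Qed.

Lemma sum_ghz (n : nat) (G : bits n.+1 -> C) :
  \sum_y G y * ghz n.+1 y = had_coef * (G [ffun => false] + G [ffun => true]).
Proof.
have cst b : (\sum_(y : bits n.+1 | y ord0 == b) G y * ghz n.+1 y) = had_coef * G [ffun => b].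
  rewrite (bigD1 [ffun => b]) ?ffunE //= big1 ?addr0.
    rewrite ghzE (_ : [forall _, _]) ?mulr1 1?mulrC //.
    by apply/forallP => k; rewrite !ffunE.
  move=> y /andP[/eqP y0 yb]; rewrite ghzE (_ : [forall _, _] = false) ?mulr0 //.
  apply/negP => /forallP h; case/eqP: yb; apply/ffunP => k.
  by rewrite ffunE (eqP (h k)).
rewrite (bigID (fun y : bits n.+1 => y ord0 == false)) /= cst mulrDr; congr (_ + _).
by rewrite -cst; apply: eq_bigl => y; case: (y ord0).
Qed.

(** * From GHZ states to Bell pairs *)

(* X-basis measurement of every qubit except a and b, followed by a reset to |0>;
   a and b discard a fair coin. *)
Definition ghz_measure (N : nat) (a b k : 'I_N) (j : 'I_2) : qop := fun x y =>
  had_coef * (if (k == a) || (k == b) then (x == y)%:R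
              else (~~ x)%:R * (-1) ^+ ((0 < j)%N && y)).

(** The sign of the all-ones term after the measurement, with a factor -1 for each measured GHZ
    qubit of outcome 1. Qubits outside the range of [f] hold 0 and give no sign. *)
Definition ghz_phase (n N : nat) (f : 'I_n -> 'I_N) (a b : 'I_N)
    (j : 'I_N -> 'I_2) : C :=
  \prod_(k | (k != a) && (k != b)) (-1) ^+ ((0 < j k)%N && (k \in codom f)).

Definition ghz_correct (N : nat) (a : 'I_N) (tau : C) (k : 'I_N) : qop :=
  fun x y => (x == y)%:R * (if (k == a) && x then tau else 1).

Definition ghz_to_bell (n N : nat) (f : 'I_n -> 'I_N) (a b : 'I_N) : locc N :=
  LRound (m := fun=> 2%N) (ghz_measure a b) (fun j =>
  LRound (m := fun=> 1%N) (fun k _ => ghz_correct a (ghz_phase f a b j) k) (fun=> LDone)).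

Lemma ghz_phase_sq (n N : nat) (f : 'I_n -> 'I_N) a b j : ghz_phase f a b j ^+ 2 = 1.
Proof. by rewrite -prodrXl big1 // => k _; rewrite sqrr_sign. Qed.

Lemma cconj_ghz_phase (n N : nat) (f : 'I_n -> 'I_N) a b j :
  cconj (ghz_phase f a b j) = ghz_phase f a b j.
Proof. by rewrite cconj_prod; apply: eq_bigr => k _; rewrite cconj_sign. Qed.

Lemma ghz_to_bell_valid (n N : nat) (f : 'I_n -> 'I_N) (a b : 'I_N) :
  locc_valid (ghz_to_bell f a b).
Proof.
have conj01 (c : bool) : cconj c%:R = c%:R by exact: conjC_nat.
split=> [k u v|j]; last first.
  split=> // k u v; rewrite big_ord1 big_bool /ghz_correct /=.
  set tau := ghz_phase _ _ _ _.
  have tau2 : cconj tau * tau = 1 by rewrite cconj_ghz_phase -expr2 ghz_phase_sq.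
  rewrite !cconjM !conj01; case: ((k == a)); case: u; case: v => /=;
    by rewrite ?mul1r ?mul0r ?mulr0 ?addr0 ?add0r //= ?tau2 /cconj ?rmorph1 ?mulr1.
have h2 : had_coef * had_coef + had_coef * had_coef = 1.
  by rewrite -expr2 had_coef2; field.
rewrite !big_ord_recl big_ord0 addr0 !big_bool /ghz_measure /= !cconjM cconj_had_coef.
case: ifP => _ /=.
  rewrite !conj01; case: u; case: v => /=;
  by rewrite ?mulr1 ?mulr0 ?mul0r ?addr0 ?add0r.
rewrite !cconjM !cconj_sign /cconj !mulr0n !mulr1n rmorph0 rmorph1.
by case: u; case: v => /=;
  rewrite ?mul0r ?mulr0 ?mul1r ?mulr1 ?expr0 ?expr1 ?add0r ?mulr1 ?mulrN ?mulNr
    ?opprK ?mulr1 ?subrr ?h2.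
Qed.

Lemma prod_zero_off (N : nat) (a b : 'I_N) (x : bits N) :
  \prod_(k | (k != a) && (k != b)) (~~ x k)%:R
  = [forall k, (k \notin codom (pair_map a b)) ==> ~~ x k]%:R :> C.
Proof.
have codE k : (k \notin codom (pair_map a b)) = (k != a) && (k != b).
  rewrite -negb_or; congr (~~ _); apply/codomP/orP => [[i ->]|].
    by rewrite /pair_map; case: ifP; [left|right].
  by case=> /eqP ->; [exists ord0|exists ord_max].
case: (boolP [forall k, _]) => [/forallP h|/forallPn[k]].
  by rewrite big1 // => k kab; have := h k; rewrite codE kab /= => ->.
by rewrite codE negb_imply negbK => /andP[kab xk]; rewrite (bigD1 k) //= xk mul0r.
Qed.

(** For all outcomes the measured vector is proportional to |00> + tau |11> on the two chosen
    qubits, with all others reset to 0. The correction multiplies the second term by [tau], and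
    tau^2 = 1. *)
Lemma ghz_to_bell_achieves (n N : nat) (f : 'I_n.+1 -> 'I_N) (i i' : 'I_n.+1) :
    injective f -> f i != f i' ->
  locc_achieves (ghz_to_bell f (f i) (f i')) (embed f (ghz n.+1))
    (embed (pair_map (f i) (f i')) bell).
Proof.
move=> fI ab j1 j2; set a := f i in ab *; set b := f i' in ab *.
set tau := ghz_phase f a b j1; set psi1 := prod_apply _ (embed _ _).
pose beta : C := ((Num.sqrt (2 : R))^-1 +i* 0)%C.
have beta0 : beta != 0 by rewrite eq_complex /= invr_eq0 sqrtr_eq0 eqxx andbT -ltNge ltr0n.
have ext_cst (c : bool) k : extend f [ffun => c] k = (k \in codom f) && c.
  have [/codomP[l ->]|kf] := boolP (k \in codom f); last by rewrite extend_out.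
  by rewrite extend_f // ffunE.
(* The contribution of the constant string [c]; by [sum_ghz] the vector has no other terms. *)
have branch (x : bits N) (c : bool) :
    \prod_k ghz_measure a b k (j1 k) (x k) (extend f [ffun => c] k) =
    had_coef ^+ N * [forall k, (k \notin codom (pair_map a b)) ==> ~~ x k]%:R
    * ((x a == c)%:R * (x b == c)%:R * (if c then tau else 1)).
  rewrite big_split /= prodr_const card_ord -mulrA; congr (_ * _).
  rewrite (bigD1 a) //= (bigD1 b) 1?eq_sym //= !eqxx orbT /= !ext_cst !codom_f /=.
  rewrite -prod_zero_off.
  have -> : \prod_(k | (k != a) && (k != b)) (if (k == a) || (k == b)
      then (x k == extend f [ffun => c] k)%:R
      else (~~ x k)%:R * (-1) ^+ ((0 < j1 k)%N && extend f [ffun => c] k)) =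
    (\prod_(k | (k != a) && (k != b)) (~~ x k)%:R) * (if c then tau else 1) :> C.
    transitivity (\prod_(k | (k != a) && (k != b)) ((~~ x k)%:R *
        (-1) ^+ [&& (0 < j1 k)%N, k \in codom f & c]) : C).
      by apply: eq_bigr => k /andP[/negbTE-> /negbTE->]; rewrite ext_cst.
    rewrite big_split /=; congr (_ * _); case: c.
      by apply: eq_bigr => k _; rewrite andbT.
    by rewrite big1 // => k _; rewrite !andbF.
  by rewrite [RHS]mulrCA -mulrA.
(* One factor [had_coef] from each Kraus operator and one from the GHZ amplitude, divided by the
   Bell amplitude. *)
exists (had_coef ^+ N.+1 / beta); apply/ffunP => x.
rewrite -[ghz_correct _ _]/(fun k x y => _) prod_apply_diag.
have -> : \prod_k (if (k == a) && x k then tau else 1) = (if x a then tau else 1).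
  by rewrite (bigD1 a) //= eqxx big1 ?mulr1 // => k /negbTE->.
rewrite /psi1 prod_apply_embed //.
rewrite (sum_ghz (fun y => \prod_k ghz_measure a b k (j1 k) (x k) (extend f y k))).
rewrite !branch !ffunE /pair_map /= -/beta.
have tau2 : tau * tau = 1 by rewrite -expr2 ghz_phase_sq.
set h := had_coef; set Z := [forall k, _].
have -> : (if Z then if x a == x b then beta else 0 else 0) = Z%:R * (x a == x b)%:R * beta.
  by case: Z; case: (x a == x b); rewrite ?mul1r ?mul0r.
have scaleE (u v : C) : u *: v = u * v by [].
rewrite exprS scaleE [RHS]mulrA [h * h ^+ N / beta * _]mulrAC [RHS]mulfVK // [RHS]mulrA.
by case: (x a); case: (x b);
  rewrite /= !(mulr0n, mulr1n, mulr0, mul0r, addr0, add0r, mul1r, mulr1) //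
    ?(mulrCA tau) ?[tau * _]mulrC -?mulrA ?tau2 ?mulr1.
Qed.

(** The image of [f] is an admissible set: for any two of its qubits, [P] is followed by the
    projection onto their Bell pair. *)
Lemma NLE_ge (n N : nat) (psi : vec N) (f : 'I_n.+1 -> 'I_N) (P : locc N) :
    injective f -> locc_valid P -> locc_achieves P psi (embed f (ghz n.+1)) ->
  n.+1%:R <= NLE psi.
Proof.
move=> fI Pv Pa; rewrite /NLE ler_nat.
have -> : n.+1 = #|f @: 'I_n.+1| by rewrite card_imset // card_ord.
apply: leq_bigmax_cond; apply/asboolP => _ _ /imsetP[i _ ->] /imsetP[i' _ ->] ab.
exists (locc_seq P (ghz_to_bell f (f i) (f i'))); split.
  by apply: locc_seq_valid => //; exact: ghz_to_bell_valid.
exact: locc_seq_achieves Pa (ghz_to_bell_achieves fI ab).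
Qed.

(** * Resources that produce grid states *)

Lemma overlap_leW (N : nat) (S : vec N -> Prop) (psi : vec N) (mu mu' : C) :
  mu <= mu' -> overlap_le S psi mu -> overlap_le S psi mu'.
Proof.
move=> mm h w Sw; apply: (le_trans (h w Sw)).
by rewrite -!mulrA ler_wpM2r // mulr_ge0 ?inner_ge0.
Qed.

Lemma grid_state_overlap_le (m n : nat) (S : {set 'I_n}) :
    (3 <= m)%N -> n = (4 ^ m)%N -> (n <= 4 * #|S|)%N -> (n <= 4 * #|~: S|)%N ->
  overlap_le (cut_product S) (graph_state (grid_adj (2 ^ m)%N) n) (2^-1 ^+ (2 ^ (m - 3))).
Proof.
move=> m3 n4 S4 SC4.
have nk : n = (2 ^ m * 2 ^ m)%N by rewrite n4 -expnMn.
have ok : ~~ odd (2 ^ m) by rewrite oddX /= orbF -lt0n; lia.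
have k0 : (0 < 2 ^ m)%N by rewrite expn_gt0.
have [L [s [t [kL sS tS st]]]] := grid_induced_matching nk k0 ok S4 SC4.
apply: overlap_leW (graph_state_overlap_le (@grid_adj_sym _) sS tS st).
apply: ler_wiXn2l; rewrite ?invr_ge0 ?ler0n //.
  by rewrite invf_le1 ?ltr0n // ler1n.
have e8 : (2 ^ m = 8 * 2 ^ (m - 3))%N by rewrite -[8%N]/(2 ^ 3)%N -expnD subnKC.
by move: kL; rewrite {1}e8 leq_pmul2l.
Qed.

(** A preparable family has a member for every [n]; at n = 4^m the truncated logarithm recovers the
    side 2^m of the grid. *)
Definition grid_family (n : nat) : vec n := graph_state (grid_adj (2 ^ trunc_log 4 n)%N) n.

Lemma grid_resource_overlap_le (m N : nat) (psi : vec N) (f : 'I_(4 ^ m) -> 'I_N)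
    (P : locc N) (A : {set 'I_N}) :
    (3 <= m)%N -> injective f -> locc_valid P ->
    locc_achieves P psi (embed f (grid_family (4 ^ m))) ->
    (4 ^ m <= 4 * #|f @^-1: A|)%N -> (4 ^ m <= 4 * #|~: (f @^-1: A)|)%N ->
  overlap_le (cut_product A) psi (2^-1 ^+ (2 ^ (m - 3))).
Proof.
move=> m3 fI Pv Pa A4 AC4.
apply: (locc_overlap_le (half_exprC_ge0 _) (@cut_product_prod_apply _ A) Pv Pa).
apply: overlap_le_embed => //; first exact: half_exprC_ge0.
by rewrite /grid_family trunc_expnK //; exact: grid_state_overlap_le.
Qed.

(** * Exponential growth against logarithmic bounds *)

Lemma leq_expl (a b e : nat) : (a <= b)%N -> (a ^ e <= b ^ e)%N.
Proof. by case: e => // e ab; rewrite leq_exp2r. Qed.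

Lemma expn2_linear (B : nat) : exists t, (B * t.+1 < 2 ^ t)%N.
Proof.
have lin s : (2 * (s + 3) + 1 <= 2 ^ (s + 3))%N.
  by elim: s => // s IH; rewrite addSn expnS; lia.
(* Of the two factors 2^(B + 3), one exceeds B and the other is at least t + 1 = 2 (B + 3) + 1. *)
exists ((B + 3) + (B + 3))%N; rewrite expnD.
have lt := lin B; have B2 : (B.+1 <= 2 ^ (B + 3))%N by lia.
by apply: (@leq_trans (B.+1 * (2 * (B + 3) + 1))); [lia | apply: leq_mul].
Qed.

(** A polynomial bound on N in 4^m makes log2 N linear in m, whereas the left side of the inequality
    is exponential in m. *)
Lemma exp_not_log_bounded (c : R) (d : nat) :
  (forall m, (3 <= m)%N -> exists N : nat,
     [/\ (0 < N)%N, (N <= d * (4 ^ m).+1 ^ d)%N &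
         (2 ^ (m - 3))%:R <= c * (1 + log2 N%:R)]) -> False.
Proof.
move=> h; pose c0 := Num.bound `|c|.
(* At m = t + 3 one has log2 N <= d (2t + 8), and 1 + d (2t + 8) <= (1 + 8d) (t + 1). *)
have [t] := expn2_linear (c0 * (1 + d * 8))%N; apply/negP; rewrite -leqNgt.
have [N [N0 Nd cN]] := h (t + 3)%N (leq_addl _ _); rewrite addnK in cN.
have logN : log2 (N%:R) <= (d * (2 * (t + 3) + 2))%:R.
  rewrite -[leRHS]log2_pow2; apply: ler_log2; first by rewrite ltr0n.
  rewrite -natrX ler_nat; apply: (leq_trans Nd).
  have -> : (2 ^ (d * (2 * (t + 3) + 2)) = 2 ^ d * (2 ^ (2 * (t + 3) + 1)) ^ d)%N.
    by rewrite -expnM -expnD; congr (2 ^ _)%N; lia.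
  apply: leq_mul; first by apply/ltnW/ltn_expl.
  apply: leq_expl.
  by rewrite addn1 expnS expnM -[(2 ^ 2)%N]/4%N mul2n -addnn -addn1 leq_add2l expn_gt0.
have cc0 : c <= c0%:R by apply: (le_trans (ler_norm c)); exact: ltW (archi_boundP (normr_ge0 c)).
have logN0 : 0 <= log2 (N%:R).
  by rewrite /log2 divr_ge0 ?ln_ge0 ?ler1n // ltW // ln2_gt0.
have : ((2 ^ t)%:R : R) <= (c0 * (1 + d * (2 * (t + 3) + 2)))%:R.
  apply: (le_trans cN); rewrite natrM natrD; apply: (le_trans (ler_wpM2r _ cc0)).
    by rewrite addr_ge0.
  by apply: ler_wpM2l => //; rewrite lerD2l.
rewrite ler_nat => /leq_trans; apply; rewrite -mulnA leq_mul2l; apply/orP; right.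
by nia.
Qed.

(** * Refutation of universality for each of the five measures *)

Theorem theorem10 (Nq : nat -> nat) (psi : forall i, vec (Nq i))
  (Hstate : forall i, is_state (psi i)) :
  (log_scaling Ewd Nq psi \/ log_scaling chiwd Nq psi \/
   log_scaling NLE Nq psi \/ log_scaling Eg Nq psi \/
   log_scaling Es Nq psi) ->
  ~ eff_universal Nq psi.
Proof.
have n2 m : (3 <= m)%N -> (2 <= 4 ^ m)%N.
  by move=> m3; apply: (@leq_trans (4 ^ 1)%N) => //; rewrite leq_pexp2l //; lia.
have N0 n N (f : 'I_n -> 'I_N) : injective f -> (0 < n)%N -> (0 < N)%N.
  by move=> fI n0; apply: leq_trans n0 _; have := leq_card f fI; rewrite !card_ord.
(* The common skeleton: a preparable family that forces [M] to be at least 2^(m - 3) at size 4^m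
   contradicts logarithmic scaling. *)
have refute (M : forall N, vec N -> R) (phi : forall n, vec n) : poly_preparable phi ->
    (forall m N (chi : vec N) (f : 'I_(4 ^ m) -> 'I_N) (P : locc N), (3 <= m)%N ->
       is_state chi -> injective f -> locc_valid P ->
       locc_achieves P chi (embed f (phi (4 ^ m)%N)) -> (2 ^ (m - 3))%:R <= M N chi) ->
    log_scaling M Nq psi -> ~ eff_universal Nq psi.
  move=> phiP Mge [c Mc] /(_ phi phiP)[idx [d univ]].
  apply: (@exp_not_log_bounded c d) => m m3.
  have n0 : (0 < 4 ^ m)%N by rewrite expn_gt0.
  have [Nle [f [fI [P [Pv [_ Pa]]]]]] := univ _ n0.
  exists (Nq (idx (4 ^ m)%N)); split=> //; first exact: N0 fI n0.
  by apply: le_trans (Mc _); apply: Mge Pa.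
have gridP : poly_preparable grid_family.
  exact: (graph_state_preparable (fun n => grid_adj (2 ^ trunc_log 4 n)%N)).
(* For [Eg] and [Es] a single balanced cut suffices, taken from an arbitrary subcubic tree. *)
have one_cut m N (chi : vec N) (f : 'I_(4 ^ m) -> 'I_N) (P : locc N) : (3 <= m)%N ->
    injective f -> locc_valid P -> locc_achieves P chi (embed f (grid_family (4 ^ m)%N)) ->
    exists A : {set 'I_N}, overlap_le (cut_product A) chi (2^-1 ^+ (2 ^ (m - 3))).
  move=> m3 fI Pv Pa.
  have N2 : (2 <= N)%N.
    by apply: leq_trans (n2 m m3) _; have := leq_card f fI; rewrite !card_ord.
  have [T] := subcubic_tree_exists N2.
  have [p [_ p1 p2]] := tree_balanced_edge T fI (n2 m m3).
  by exists (cut_side p.1 p.2); apply: grid_resource_overlap_le Pa p1 p2.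
case=> [|[|[|[]]]].
- apply: (refute _ _ gridP) => m N chi f P m3 chi1 fI Pv Pa.
  apply: (tree_measure_ge fI (n2 m m3)) => A A1 A2; apply: entropy_ge => //.
  exact: grid_resource_overlap_le Pa A1 A2.
- apply: (refute _ _ gridP) => m N chi f P m3 chi1 fI Pv Pa.
  apply: (tree_measure_ge fI (n2 m m3)) => A A1 A2; apply: logrank_ge => //.
  exact: grid_resource_overlap_le Pa A1 A2.
- apply: (refute _ _ ghz_preparable) => m N chi f P m3 _ fI Pv Pa.
  apply: (@le_trans _ _ (4 ^ m)%:R).
    rewrite ler_nat; apply: (@leq_trans (2 ^ m)%N); first by rewrite leq_pexp2l // leq_subr.
    by apply: leq_expl.
  (* [NLE_ge] speaks of successor sizes, where qubit 0 of the GHZ state exists. *)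
  have e4 : (4 ^ m = (4 ^ m).-1.+1)%N by rewrite prednK // expn_gt0.
  by move: f fI Pa; rewrite e4 => f fI Pa; apply: NLE_ge Pa.
- apply: (refute _ _ gridP) => m N chi f P m3 chi1 fI Pv Pa.
  by have [A hA] := one_cut _ _ _ _ _ m3 fI Pv Pa; apply: Eg_ge hA.
- apply: (refute _ _ gridP) => m N chi f P m3 chi1 fI Pv Pa.
  by have [A hA] := one_cut _ _ _ _ _ m3 fI Pv Pa; apply: Es_ge hA.
Qed.
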